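(* The periodic peakons $c\varphi(x-ct)$, $c\in\mathbb{R}$, of the $\mu$-Camassa-Holm equation $$\mu(u_t)-u_{xxt}=-2\mu(u)u_x+2u_xu_{xx}+uu_{xxx},\qquad t>0,\ x\in S^1,$$ are orbitally stable in $H^1(S^1)$. Precisely: for $c\in\mathbb{R}$ and every $\epsilon>0$ there is a $\delta>0$ such that if $u\in C([0,T);H^1(S^1))$ is a weak solution of this equation on $[0,T)$ with $$\|u(\cdot,0)-c\varphi\|_{H^1(S^1)}<\delta,$$ then $$\|u(\cdot,t)-c\varphi(\cdot-\xi(t)+1/2)\|_{H^1(S^1)}<\epsilon\qquad\text{for } t\in[0,T),$$ where $\xi(t)\in\mathbb{R}$ is any point where the function $u(\cdot,t)$ attains its maximum.
   Context: $S^1=\mathbb{R}/\mathbb{Z}$; functions on $S^1$ are real-valued and are identified with functions on $\mathbb{R}$ of period one. $H^1(S^1)$ is the Sobolev space with norm $\|f\|_{H^1(S^1)}^2=\int_{S^1}f^2\,dx+\int_{S^1}f_x^2\,dx$; its elements are identified with their continuous representatives. $\mu(f)=\int_{S^1}f\,dx$ denotes the mean of $f$. The function $\varphi$ is given by $\varphi(x)=\frac{1}{26}(12x^2+23)$ for $x\in[-1/2,1/2]$, extended to $\mathbb{R}$ with period one. For any $c\in\mathbb{R}$, the peakon with speed $c$ is the traveling wave $u(x,t)=c\varphi(x-ct)$. Orbital stability means that a periodic wave with an initial profile close to a peakon remains close to some translate of it for all later times at which it exists. For $u\in H^1(S^1)$ define $$H_0[u]=\int_{S^1}u\,dx,\qquad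 H_1[u]=\frac12\Big(\mu(u)^2+\int_{S^1}u_x^2\,dx\Big),\qquad H_2[u]=\int_{S^1}\Big(\mu(u)u^2+\frac12uu_x^2\Big)dx.$$ Let $A=\mu-\partial_x^2$, i.e. $Af=\mu(f)-f_{xx}$, which is an isomorphism between $H^s(S^1)$ and $H^{s-2}(S^1)$. A weak solution of the $\mu$-Camassa-Holm equation on $[0,T)$, with $T>0$, is a function $u\in C([0,T);H^1(S^1))$ such that $$u_t+uu_x+A^{-1}\partial_x\Big(2\mu(u)u+\frac12u_x^2\Big)=0$$ holds in the sense of distributions and such that $H_0[u(\cdot,t)]$, $H_1[u(\cdot,t)]$, $H_2[u(\cdot,t)]$ are independent of $t\in[0,T)$.
   Formalization: For c<0 the claim with a maximum point fails (u=cφ(x-ct) at t=0 has its maximum at 0, half a period from the peak), so for c<0 ξ(t) is taken to be any point where u(·,t) attains its minimum; for c≥0 it is any maximum point as stated. *)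

(* Defs.v *)
From HB Require Import structures.
From mathcomp Require Import all_boot all_order all_algebra.
From mathcomp Require Import all_classical all_reals all_analysis.
Set Implicit Arguments.
Unset Strict Implicit.
Unset Printing Implicit Defensive.
Import Order.TTheory GRing.Theory Num.Theory.
Import numFieldNormedType.Exports.
Local Open Scope classical_set_scope.
Local Open Scope ring_scope.

Section circle.
Context {R : realType}.
Implicit Types (f g p psi : R -> R) (D : (R -> R) -> R).

(* Functions on the circle R/Z are functions R -> R of period 1, and integrals
   over the circle are Lebesgue integrals over [0, 1]. *)
Definition circle_int f : R :=
  \int[@lebesgue_measure R]_(x in `[0, 1]) f x.

Definition mean f : R := circle_int f.

Definition L2 g : Prop :=
  [/\ periodic g 1,
      measurable_fun [set: R] g &
      (@lebesgue_measure R).-integrable `[0, 1] (fun x => (g x ^+ 2)%:E)].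

(* Distributions on the circle are given by their values on smooth periodic
   test functions; values on other functions are irrelevant. *)
Definition test psi : Prop :=
  periodic psi 1 /\ forall n x, derivable (derive1n n psi) x 1.

Definition dist_eq D1 D2 : Prop := forall psi, test psi -> D1 psi = D2 psi.

Definition dist_of f : (R -> R) -> R :=
  fun psi => circle_int (fun x => f x * psi x).

Definition dist_dx D : (R -> R) -> R := fun psi => - D (derive1 psi).

(* The mean of a distribution is its value on the constant function 1. *)
Definition dist_mean D : R := D (cst 1).

Definition dist_A D : (R -> R) -> R :=
  fun psi => dist_of (cst (dist_mean D)) psi - dist_dx (dist_dx D) psi.

(* A^{-1} D, when it is a continuous function.  This is the case for
   D = dist_dx (dist_of h) with h integrable, the only D used below; the
   continuous p is then unique. *)
Definition A_inv D : R -> R :=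
  xget (cst 0)
    [set p : R -> R | [/\ periodic p 1, continuous p &
                           dist_eq (dist_A (dist_of p)) D]].

Definition weak_deriv f g : Prop :=
  dist_eq (dist_dx (dist_of f)) (dist_of g).

(* Elements of H^1 are represented by their continuous representatives. *)
Definition sobolev1 f : Prop :=
  [/\ periodic f 1, continuous f & exists2 g, L2 g & weak_deriv f g].

(* The weak derivative of f in L^2, which is unique up to a null set. *)
Definition wderiv f : R -> R :=
  xget (cst 0) [set g : R -> R | L2 g /\ weak_deriv f g].

Definition H1norm f : R :=
  Num.sqrt (circle_int (fun x => f x ^+ 2)
            + circle_int (fun x => wderiv f x ^+ 2)).

Definition ham0 f : R := circle_int f.

Definition ham1 f : R :=
  2^-1 * (mean f ^+ 2 + circle_int (fun x => wderiv f x ^+ 2)).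

Definition ham2 f : R :=
  circle_int (fun x => mean f * f x ^+ 2 + 2^-1 * (f x * wderiv f x ^+ 2)).

(* For every real x, the point x - floor (x + 1/2) is the representative of x
   modulo 1 in [-1/2, 1/2). *)
Definition phi (x : R) : R :=
  let y := x - (Num.floor (x + 2^-1))%:~R in 26^-1 * (12 * y ^+ 2 + 23).

End circle.

Section space_time.
Context {R : realType}.
Implicit Types (T : \bar R) (u th : R -> R -> R).

(* The arguments of a function on space-time are the time and then the space
   variable. *)
Definition dt th : R -> R -> R := fun t x => derive1 (th ^~ x) t.
Definition dx th : R -> R -> R := fun t => derive1 (th t).

Definition partials (w : seq bool) th : R -> R -> R :=
  foldr (fun (b : bool) f => if b then dt f else dx f) th w.

(* All iterated partial derivatives, in any order, exist and are continuous. *)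
Definition smooth2 th : Prop :=
  forall w : seq bool,
    continuous (fun z : R * R => partials w th z.1 z.2) /\
    forall t x, derivable ((partials w th) ^~ x) t 1 /\
                derivable (partials w th t) x 1.

(* Test functions on (0, T) x S^1. *)
Definition test2 T th : Prop :=
  [/\ smooth2 th,
      forall t, periodic (th t) 1 &
      exists a b : R, [/\ 0 < a, (b%:E < T)%E &
        forall t x, th t x != 0 -> a <= t <= b]].

Definition nonlocal_term u (t : R) : R -> R :=
  A_inv (dist_dx (dist_of
    (fun x => 2 * mean (u t) * u t x + 2^-1 * wderiv (u t) x ^+ 2))).

Definition muCH_distr T u : Prop :=
  forall th, test2 T th ->
    \int[@lebesgue_measure R]_(t in [set t : R | 0 < t /\ (t%:E < T)%E])
      circle_int (fun x =>
        - (u t x * dt th t x)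
        + (u t x * wderiv (u t) x + nonlocal_term u t x) * th t x) = 0.

Definition continuous_in_H1 T u : Prop :=
  (forall t : R, 0 <= t -> (t%:E < T)%E -> sobolev1 (u t)) /\
  forall s : R, 0 <= s -> (s%:E < T)%E -> forall e : R, 0 < e ->
    exists2 d : R, 0 < d &
      forall t : R, 0 <= t -> (t%:E < T)%E -> `|t - s| < d ->
        H1norm (fun x => u t x - u s x) < e.

(* T = +oo is allowed.  The values of u at times outside [0, T) are
   irrelevant. *)
Definition weak_solution T u : Prop :=
  [/\ (0 < T)%E, continuous_in_H1 T u, muCH_distr T u &
      forall t : R, 0 <= t -> (t%:E < T)%E ->
        [/\ ham0 (u t) = ham0 (u 0), ham1 (u t) = ham1 (u 0) &
            ham2 (u t) = ham2 (u 0)]].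

End space_time.

Definition is_max_point (R : realType) (f : R -> R) (xi : R) : Prop :=
  forall x, f x <= f xi.

Definition is_min_point (R : realType) (f : R -> R) (xi : R) : Prop :=
  forall x, f xi <= f x.

(* The peak of c phi, located at 1/2 modulo 1, is a maximum for c > 0 and a
   minimum for c < 0, the two cases being exchanged by the symmetry
   u(t, x) |-> - u(t, - x) of the equation.  For c < 0 the maximum of c phi is
   at its smooth crest, half a period away from the peak. *)
Definition is_peak_point (R : realType) (c : R) (f : R -> R) (xi : R) : Prop :=
  if 0 <= c then is_max_point f xi else is_min_point f xi.

(* Main.v *)
Require Import Defs.
From mathcomp Require Import all_boot all_order all_algebra.
From mathcomp Require Import all_classical all_reals all_analysis.
From mathcomp Require Import measurable_realfun.
From mathcomp Require Import ring lra.
Import Order.TTheory GRing.Theory Num.Theory.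
Import numFieldNormedType.Exports.
Local Open Scope classical_set_scope.
Local Open Scope ring_scope.

(* Only the conservation laws matter. Replacing u by u/c reduces to c = 1; for
   c < 0 this turns minima into maxima. Let v have mean mu, maximum M = v(xi)
   and minimum m, and put E = int v_x^2.
   1. Since phi_xx = 12/13 - (12/13) delta_peak, the integral of v_x against the
      derivative of phi(. - xi + 1/2) is 12/13 (M - mu). Hence the squared H^1
      distance from v to the translate is bounded by a multiple of
      |mu - 12/13| + |E - 12/169| + max(0, 1 - M).
   2. From (M - v) (v_x - sqrt(24/13 (v - m)))^2 >= 0 and the analogue with +,
      integrated over one period, which runs at least once up and once down
      between m and M, one gets an inequality relating M, m, mu, E and the third
      conserved quantity. For the values of phi it holds for no (M, m) other
      than (1, 23/26), with a quadratic margin, so M >= 1 - O(sqrt(delta)). The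
      margin is global, so no continuity in time is needed.
   The chain and product rules for H^1 functions come from a bisection argument
   applied to v(t) - v(s) = int_s^t v_x; this identity and the uniqueness of weak
   derivatives are obtained by testing with primitives of the trigonometric
   kernels cos(pi x)^(2n). *)

Set Implicit Arguments.
Unset Strict Implicit.
Unset Printing Implicit Defensive.

(** * Integrals over intervals and the calculus of absolutely continuous functions *)

Section interval_integral.
Context {R : realType}.
Implicit Types (a b c x : R) (f g F G : R -> R).
Local Notation mu := (@lebesgue_measure R).

Definition itv_int a b f : R := \int[mu]_(x in `[a, b]) f x.
Definition itv_integrable a b f : Prop := mu.-integrable `[a, b] (EFin \o f).

Lemma itv_integrableS a b a' b' f : a <= a' -> b' <= b ->
  itv_integrable a b f -> itv_integrable a' b' f.
Proof.
move=> aa' bb'; apply: integrableS => //.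
by apply: subset_itv; rewrite bnd_simp.
Qed.

Lemma itv_integrableD a b f g : itv_integrable a b f -> itv_integrable a b g ->
  itv_integrable a b (fun x => f x + g x).
Proof.
move=> fi gi.
exact: (@integrableD _ _ _ mu `[a, b]%classic _ (EFin \o f) (EFin \o g)).
Qed.

Lemma itv_integrableB a b f g : itv_integrable a b f -> itv_integrable a b g ->
  itv_integrable a b (fun x => f x - g x).
Proof.
move=> fi gi.
exact: (@integrableB _ _ _ mu `[a, b]%classic _ (EFin \o f) (EFin \o g)).
Qed.

Lemma itv_integrableZ a b (k : R) f : itv_integrable a b f ->
  itv_integrable a b (fun x => k * f x).
Proof. by move=> fi; exact: (@integrableZl _ _ _ mu `[a, b]%classic _ k (EFin \o f)). Qed.

Lemma itv_integrable_norm a b f : itv_integrable a b f ->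
  itv_integrable a b (fun x => `|f x|).
Proof. by move=> fi; exact: integrable_norm. Qed.

Lemma itv_integrable_cont a b f : continuous f -> itv_integrable a b f.
Proof.
move=> fc; apply: continuous_compact_integrable; first exact: segment_compact.
exact: continuous_subspaceT.
Qed.

Lemma itv_integrable_cst a b (k : R) : itv_integrable a b (fun=> k).
Proof. by apply: itv_integrable_cont => x; exact: cvg_cst. Qed.

Lemma itv_integrable_le a b f g : measurable_fun [set: R] f ->
  itv_integrable a b g -> (forall x, a <= x <= b -> `|f x| <= g x) ->
  itv_integrable a b f.
Proof.
move=> mf gi fg; apply: (le_integrable _ _ _ gi) => //.
  by apply/measurable_EFinP; exact: measurable_funS mf.
move=> x; rewrite /= in_itv/= => /fg fgx.
by rewrite lee_fin (le_trans fgx) ?ler_norm.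
Qed.

Lemma itv_integrableM a b f g : continuous f -> itv_integrable a b g ->
  itv_integrable a b (fun x => f x * g x).
Proof.
move=> fc gi.
apply: (@integrableMr _ _ _ mu `[a, b]%classic _ f (EFin \o g)) => //.
  apply: measurable_funS (continuous_measurable_fun fc) => //.
have /compact_bounded[M [_ mrt]] :=
  continuous_compact (@continuous_subspaceT _ _ `[a, b] _ fc)
    (segment_compact (a := a) (b := b)).
by exists M; split; rewrite ?num_real // => ? ? ? ?; exact: mrt.
Qed.

Lemma eq_itv_int a b f g : (forall x, a <= x <= b -> f x = g x) ->
  itv_int a b f = itv_int a b g.
Proof. by move=> fg; apply: eq_Rintegral => x; rewrite inE/= in_itv/= => /fg. Qed.

Lemma itv_intD a b f g : itv_integrable a b f -> itv_integrable a b g ->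
  itv_int a b (fun x => f x + g x) = itv_int a b f + itv_int a b g.
Proof. by move=> fi gi; exact: RintegralD. Qed.

Lemma itv_intB a b f g : itv_integrable a b f -> itv_integrable a b g ->
  itv_int a b (fun x => f x - g x) = itv_int a b f - itv_int a b g.
Proof. by move=> fi gi; exact: RintegralB. Qed.

Lemma itv_intZ a b (k : R) f : itv_integrable a b f ->
  itv_int a b (fun x => k * f x) = k * itv_int a b f.
Proof. by move=> fi; exact: RintegralZl. Qed.

Lemma itv_int_cst a b (k : R) : a <= b ->
  itv_int a b (fun=> k) = k * (b - a).
Proof.
move=> ab; rewrite /itv_int Rintegral_cst//=.
rewrite lebesgue_measure_itv/= lte_fin.
by case: ltgtP ab => // -> _; rewrite subrr.
Qed.

Lemma le_itv_int a b f g : itv_integrable a b f -> itv_integrable a b g ->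
  (forall x, a <= x <= b -> f x <= g x) -> itv_int a b f <= itv_int a b g.
Proof. by move=> fi gi fg; apply: le_Rintegral => // x; rewrite /= in_itv/= => /fg. Qed.

Lemma itv_int_ge0 a b f : (forall x, a <= x <= b -> 0 <= f x) ->
  0 <= itv_int a b f.
Proof. by move=> f0; apply: Rintegral_ge0 => x; rewrite /= in_itv/= => /f0. Qed.

Lemma ler_norm_itv_int a b f : itv_integrable a b f ->
  `|itv_int a b f| <= itv_int a b (fun x => `|f x|).
Proof. by move=> fi; exact: le_normr_Rintegral. Qed.

Lemma itv_int_split a b c f : a <= b -> b <= c -> itv_integrable a c f ->
  itv_int a c f = itv_int a b f + itv_int b c f.
Proof.
move=> ab bc fi; apply/eqP; rewrite addrC -subr_eq; apply/eqP.
rewrite /itv_int Rintegral_itvB ?bnd_simp//.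
rewrite Rintegral_itv_obnd_cbnd//; apply: integrableS fi => //.
by apply: subset_itv; rewrite bnd_simp.
Qed.

Lemma itv_int_point a f : itv_int a a f = 0.
Proof. by rewrite /itv_int set_itv1 Rintegral_set1. Qed.

(* Bisection: an error that is small relative to an additive majorant on short
   intervals is small on all intervals. *)
Lemma eq_increment_itv_int (W w k : R -> R) :
  itv_integrable 0 1 w -> itv_integrable 0 1 k ->
  (forall e, 0 < e -> exists2 d, 0 < d & forall s t, 0 <= s -> s <= t ->
     t <= 1 -> t - s < d ->
     `|W t - W s - itv_int s t w| <= e * itv_int s t k) ->
  forall s t, 0 <= s -> s <= t -> t <= 1 -> W t - W s = itv_int s t w.
Proof.
move=> wi ki loc s t s0 st t1.
suff H e : 0 < e -> `|W t - W s - itv_int s t w| <= e * itv_int s t k.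
  apply/eqP; rewrite -subr_eq0 -normr_le0; apply/ler_addgt0Pr => e e0.
  rewrite add0r.
  have K0 : 0 < `|itv_int s t k| + 1 by rewrite ltr_wpDl.
  apply: (le_trans (H _ (divr_gt0 e0 K0))).
  rewrite mulrAC ler_pdivrMr//; apply: ler_wpM2l; first exact: ltW.
  by rewrite (le_trans (ler_norm _))// lerDl.
move=> e0; have [d d0 hd] := loc _ e0.
(* After n halvings the pieces are shorter than d; since the integral of k is additive, the factor e
   is not degraded by reassembling them. *)
have [n tsn] : exists n, t - s < d * 2 ^+ n.
  exists (Num.truncn ((t - s) / d)).+1.
  rewrite mulrC -ltr_pdivrMr//.
  apply: (lt_trans (truncnS_gt _)).
  by rewrite -natrX ltr_nat ltn_expl.
elim: n s t s0 st t1 tsn => [|n IH] s t s0 st t1 tsn.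
  by apply: hd => //; rewrite expr0 mulr1 in tsn.
pose m := (s + t) / 2.
have [sm mt] : s <= m /\ m <= t by rewrite /m; split; lra.
have h2 : m - s < d * 2 ^+ n /\ t - m < d * 2 ^+ n.
  by rewrite exprS in tsn; rewrite /m; split; lra.
have m1 : m <= 1 by exact: le_trans t1.
have m0 : 0 <= m by exact: le_trans sm.
rewrite (itv_int_split sm mt) ?(itv_int_split (f := k) sm mt) ?mulrDr;
  try exact: (itv_integrableS s0 t1).
have -> : W t - W s - (itv_int s m w + itv_int m t w) =
  (W m - W s - itv_int s m w) + (W t - W m - itv_int m t w) by lra.
apply: (le_trans (ler_normD _ _)); apply: lerD; apply: IH => //.
- exact: h2.1.
- exact: h2.2.
Qed.

(** Absolute continuity on [0, 1], expressed by increments: f is an almost everywhere derivative of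
    F and may be changed on a null set. *)
Definition primitive F f := itv_integrable 0 1 f /\
  forall s t, 0 <= s -> s <= t -> t <= 1 -> F t - F s = itv_int s t f.

Lemma derivable_continuous f : (forall x, derivable f x 1) -> continuous f.
Proof. by move=> fd x; exact/differentiable_continuous/derivable1_diffP. Qed.

(** Heine's theorem through the near-covering form of compactness, the radius being a variable that
    tends to [0^'+]. If F oscillates by less than e / 2 from x on a ball of radius d, then every
    centre within d / 2 of x and every radius below d / 2 will do. *)
Lemma unif_cont01 F : continuous F -> forall e, 0 < e ->
  exists2 d, 0 < d & forall x y, 0 <= x <= 1 -> 0 <= y <= 1 ->
    `|x - y| < d -> `|F x - F y| < e.
Proof.
move=> Fc e e0.
have e2 : 0 < e / 2 by rewrite divr_gt0.
have /compact_near_coveringP/(_ R 0^'+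
    (fun d x => forall y, `|x - y| < d -> `|F x - F y| < e)) :=
  segment_compact (a := 0 : R) (b := 1).
case.
- move=> x _.
  have /cvgrPdist_lt/(_ _ e2)/nbhs_ballP[d /= d0 dP] := Fc x.
  have d2 : 0 < d / 2 by rewrite divr_gt0.
  exists (ball x (d / 2), [set r : R | 0 < r /\ r < d / 2]) => /=.
    split; first exact: nbhsx_ballx.
    by apply: filterI; [exact: nbhs_right_gt|exact: nbhs_right_lt].
  move=> [z r] /= [xz [r0 rd]] y zy.
  have h1 : `|F x - F z| < e / 2.
    by apply: dP; apply: lt_trans xz _; rewrite ltr_pdivrMr// ltr_pMr// ltr1n.
  have h2 : `|F x - F y| < e / 2.
    apply: dP; rewrite /ball/=.
    have -> : x - y = (x - z) + (z - y) by lra.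
    rewrite (le_lt_trans (ler_normD _ _))// [d]splitr ltrD//.
    exact: lt_trans rd.
  have -> : F z - F y = (F x - F y) - (F x - F z) by lra.
  by rewrite (le_lt_trans (ler_normB _ _))// [e]splitr ltrD.
- move=> d [d0 dP]; exists (d / 2); first by rewrite divr_gt0.
  have dd : d / 2 < d by rewrite ltr_pdivrMr// ltr_pMr// ltr1n.
  move=> x y x01 _ xy.
  apply: (dP (d / 2) _ _ x) => //=.
  - by rewrite sub0r normrN gtr0_norm ?divr_gt0.
  - by rewrite divr_gt0.
Qed.

(** On [s, t] the error in the product rule is the integral of (G t - G x) f + (F s - F x) g.
    Uniform continuity makes both coefficients small, so bisection applies with majorant |f| +
    |g|. *)
Lemma primitiveM F G f g : continuous F -> continuous G ->
  primitive F f -> primitive G g ->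
  primitive (fun x => F x * G x) (fun x => G x * f x + F x * g x).
Proof.
move=> Fc Gc [fi Ff] [gi Gg].
have Gfi : itv_integrable 0 1 (fun x => G x * f x) by exact: itv_integrableM.
have Fgi : itv_integrable 0 1 (fun x => F x * g x) by exact: itv_integrableM.
have wi := itv_integrableD Gfi Fgi.
have ki := itv_integrableD (itv_integrable_norm fi) (itv_integrable_norm gi).
split => //; apply: (eq_increment_itv_int wi ki) => e e0.
have [d1 d10 h1] := unif_cont01 Fc e0.
have [d2 d20 h2] := unif_cont01 Gc e0.
exists (Num.min d1 d2); first by rewrite lt_min d10.
move=> s t s0 st t1; rewrite lt_min => /andP[st1 st2].
have S h : itv_integrable 0 1 h -> itv_integrable s t h.
  exact: itv_integrableS.
have -> : F t * G t - F s * G s - itv_int s t (fun x => G x * f x + F x * g x)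
  = itv_int s t (fun x => (G t - G x) * f x + (F s - F x) * g x).
  have -> : F t * G t - F s * G s = G t * (F t - F s) + F s * (G t - G s).
    by lra.
  rewrite Ff// Gg// -!itv_intZ; try exact: S.
  rewrite -itv_intD; try (apply: itv_integrableZ; exact: S).
  rewrite -itv_intB.
  - by apply: eq_itv_int => x _; lra.
  - by apply: itv_integrableD; apply: itv_integrableZ; exact: S.
  - exact: S.
have cB (H : R -> R) k : continuous H -> continuous (fun x => k - H x).
  by move=> Hc x; apply: cvgB; [exact: cvg_cst|exact: Hc].
have i1 : itv_integrable s t (fun x => (G t - G x) * f x + (F s - F x) * g x).
  by apply: itv_integrableD; apply: itv_integrableM; try exact: S; exact: cB.
apply: (le_trans (ler_norm_itv_int i1)).
rewrite -itv_intZ; last exact: S.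
apply: le_itv_int; first exact: itv_integrable_norm.
  by apply: itv_integrableZ; exact: S.
move=> x /andP[sx xt].
have x01 : 0 <= x <= 1 by rewrite (le_trans s0)//= (le_trans xt).
have s01 : 0 <= s <= 1 by rewrite s0 (le_trans st).
have t01 : 0 <= t <= 1 by rewrite t1 (le_trans s0).
rewrite (le_trans (ler_normD _ _))// !normrM mulrDr lerD//.
  apply: ler_wpM2r => //; apply/ltW/h2 => //.
  by rewrite ger0_norm ?subr_ge0//; lra.
apply: ler_wpM2r => //; apply/ltW/h1 => //.
by rewrite distrC ger0_norm ?subr_ge0//; lra.
Qed.

(** The intermediate value theorem turns the mean value point of H into F c with c in [s, t], so the
    error is the integral of (h (F c) - h (F x)) f, small against |f|. Asking for a mean value
    property on [m, M], rather than a derivative, spares the endpoint m, where a square root enters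
    H later. *)
Lemma primitive_comp F f (H h : R -> R) (m M : R) :
  continuous F -> continuous h -> primitive F f ->
  (forall x, 0 <= x <= 1 -> m <= F x <= M) ->
  (forall y z, m <= y -> y <= z -> z <= M ->
     exists2 c, y <= c <= z & H z - H y = h c * (z - y)) ->
  primitive (fun x => H (F x)) (fun x => h (F x) * f x).
Proof.
move=> Fc hc [fi Ff] FmM HH.
have hFc : continuous (fun x => h (F x)).
  by move=> x; apply: (@continuous_comp _ _ _ F h); [exact: Fc|exact: hc].
have wi : itv_integrable 0 1 (fun x => h (F x) * f x).
  exact: itv_integrableM.
split => //; apply: (eq_increment_itv_int wi (itv_integrable_norm fi)) => e e0.
have [d d0 hd] := unif_cont01 hFc e0.
exists d => // s t s0 st t1 std.
have S g : itv_integrable 0 1 g -> itv_integrable s t g.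
  exact: itv_integrableS.
have s01 : 0 <= s <= 1 by rewrite s0 (le_trans st).
have t01 : 0 <= t <= 1 by rewrite t1 (le_trans s0).
have [c [sc ct] Hc] : exists2 c, s <= c /\ c <= t & H (F t) - H (F s) = h (F c) * (F t - F s).
  have ivt y : Num.min (F s) (F t) <= y <= Num.max (F s) (F t) ->
      exists2 c, s <= c /\ c <= t & F c = y.
    move=> yst.
    have [c] := IVT st (continuous_subspaceT Fc) yst.
    by rewrite in_itv/= => /andP[sc ct] Fcy; exists c.
  have /andP[ms sM] := FmM _ s01; have /andP[mt tM] := FmM _ t01.
  have [Fst|/ltW Fts] := leP (F s) (F t).
    have [y yst ->] := HH _ _ ms Fst tM.
    by have [|c sct <-] := ivt y; [rewrite (min_idPl Fst) (max_idPr Fst)|exists c].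
  have [y yst E] := HH _ _ mt Fts sM.
  have [|c sct Fcy] := ivt y; first by rewrite (min_idPr Fts) (max_idPl Fts).
  by exists c => //; rewrite Fcy; lra.
rewrite Hc Ff// -itv_intZ; last exact: S.
rewrite -itv_intB; [|by apply: itv_integrableZ; exact: S|exact: S].
have i1 : itv_integrable s t (fun x => h (F c) * f x - h (F x) * f x).
  by apply: itv_integrableB; [apply: itv_integrableZ|]; exact: S.
apply: (le_trans (ler_norm_itv_int i1)).
rewrite -itv_intZ; last exact/S/itv_integrable_norm.
apply: le_itv_int; first exact: itv_integrable_norm.
  by apply: itv_integrableZ; exact/S/itv_integrable_norm.
move=> x /andP[sx xt].
have x01 : 0 <= x <= 1 by rewrite (le_trans s0)//= (le_trans xt).
have c01 : 0 <= c <= 1 by rewrite (le_trans s0)//= (le_trans ct).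
rewrite -mulrBl normrM; apply: ler_wpM2r => //; apply/ltW/hd => //.
by rewrite ltr_norml; apply/andP; split; lra.
Qed.

Lemma primitive_derive F f : (forall x, is_derive x 1 F (f x)) ->
  continuous f -> primitive F f.
Proof.
move=> Ff fc; split; first exact: itv_integrable_cont.
move=> s t _ st _; case: (ltgtP s t) st => // [st _|-> _]; last first.
  by rewrite itv_int_point subrr.
have Fc : continuous F.
  by apply: derivable_continuous => x; exact: (@ex_derive _ _ _ _ _ _ _ (Ff x)).
rewrite /itv_int /Rintegral (continuous_FTC2 (F := F) st).
- by [].
- exact: continuous_subspaceT.
- split => /=.
  + by move=> x _; exact: (@ex_derive _ _ _ _ _ _ _ (Ff x)).
  + by apply: cvg_at_right_filter; exact: Fc.
  + by apply: cvg_at_left_filter; exact: Fc.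
- by move=> x _; rewrite derive1E; apply: (@derive_val _ _ _ _ _ _ _ (Ff x)).
Qed.

End interval_integral.

(** * Trigonometric kernels and the fundamental theorem for weak derivatives *)

Section trigonometric_kernel.
Context {R : realType}.
Implicit Types (a b x y : R) (f g : R -> R).

Let sn y : R := sin (2 * pi * y).
Let cs y : R := cos (2 * pi * y).

(** A class closed under differentiation, so that smoothness of its members follows without
    computing iterated derivatives. The reflections a - x are those of a convolution. *)
Inductive trig_poly : (R -> R) -> Prop :=
| trig_cst k : trig_poly (fun=> k)
| trig_sin a : trig_poly (fun x => sn (a - x))
| trig_cos a : trig_poly (fun x => cs (a - x))
| trig_add f g : trig_poly f -> trig_poly g -> trig_poly (fun x => f x + g x)
| trig_mul f g : trig_poly f -> trig_poly g -> trig_poly (fun x => f x * g x).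

Let is_derive_sn y : is_derive y 1 sn (2 * pi * cs y).
Proof.
have H : is_derive y 1 (fun x : R => 2 * pi * x) (2 * pi).
  by apply: is_derive_eq; rewrite /GRing.scale/= mulr1.
rewrite mulrC; exact: (@is_derive1_comp _ sin (fun x : R => 2 * pi * x)).
Qed.

Let is_derive_cs y : is_derive y 1 cs (- (2 * pi * sn y)).
Proof.
have H : is_derive y 1 (fun x : R => 2 * pi * x) (2 * pi).
  by apply: is_derive_eq; rewrite /GRing.scale/= mulr1.
rewrite mulrC -mulNr; exact: (@is_derive1_comp _ cos (fun x : R => 2 * pi * x)).
Qed.

Lemma is_derive_reflect f df a x : is_derive (a - x) 1 f df ->
  is_derive x 1 (fun x => f (a - x)) (- df).
Proof.
move=> fd; have H : is_derive x 1 (fun x : R => a - x) (-1).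
  by apply: is_derive_eq; rewrite add0r mul1r.
by rewrite -mulrN1; exact: (@is_derive1_comp _ f (fun x : R => a - x)).
Qed.

Lemma trig_poly_derive f : trig_poly f ->
  exists2 df, trig_poly df & forall x, is_derive x 1 f (df x).
Proof.
elim=> {f} [k|a|a|f g _ [df tdf fdf] _ [dg tdg gdg]|
    f g tf [df tdf fdf] tg [dg tdg gdg]].
- by exists (fun=> 0); [exact: trig_cst|move=> x; exact: is_derive_cst].
- exists (fun x => - (2 * pi) * cs (a - x)).
    by apply: trig_mul; [exact: trig_cst|exact: trig_cos].
  by move=> x; rewrite mulNr; exact: is_derive_reflect.
- exists (fun x => 2 * pi * sn (a - x)).
    by apply: trig_mul; [exact: trig_cst|exact: trig_sin].
  by move=> x; rewrite -[X in is_derive _ _ _ X]opprK; exact: is_derive_reflect.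
- exists (fun x => df x + dg x); first exact: trig_add.
  by move=> x; exact: is_deriveD.
- exists (fun x => f x * dg x + g x * df x).
    by apply: trig_add; exact: trig_mul.
  by move=> x; exact: is_deriveM.
Qed.

Lemma trig_poly_test f : trig_poly f -> test f.
Proof.
move=> tf; split.
  elim: tf => [k|a|a|{}f g _ fp _ gp|{}f g _ fp _ gp] x //.
  - by rewrite /sn -[LHS]sinD2pi; congr sin; rewrite mulr2n; ring.
  - by rewrite /cs -[LHS]cosD2pi; congr cos; rewrite mulr2n; ring.
  - by rewrite fp gp.
  - by rewrite fp gp.
have dn n : trig_poly (derive1n n f).
  elim: n => [//|n tfn].
  have [df tdf fdf] := trig_poly_derive tfn.
  rewrite derive1nS (_ : derive1 (derive1n n f) = df)//; apply/funext => x.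
  by rewrite derive1E; apply: (@derive_val _ _ _ _ _ _ _ (fdf x)).
move=> n x; have [df _ fdf] := trig_poly_derive (dn n).
exact: (@ex_derive _ _ _ _ _ _ _ (fdf x)).
Qed.

(* The kernel is [q ^+ n] with [q y = cos(pi y)^2], normalized by its mean
   [kmean n]; [kprim n] is the periodic primitive of [q ^+ n - kmean n], from
   [(q^n sn)' = 4 pi (n+1) q^(n+1) - 2 pi (2n+1) q^n]. *)
Let q y : R := (1 + cs y) / 2.

Fixpoint kmean n : R :=
  if n is n'.+1 then (2 * n' + 1)%:R / (2 * n' + 2)%:R * kmean n' else 1.

Fixpoint kprim n : R -> R := fun y =>
  if n is n'.+1 then (2 * n' + 1)%:R / (2 * n' + 2)%:R * kprim n' y +
    (4 * pi * n'.+1%:R)^-1 * (q y ^+ n' * sn y) else 0.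

Let q_ge0 y : 0 <= q y.
Proof. by rewrite divr_ge0// -lerBlDl sub0r cos_geN1. Qed.

Let q_lt1 y : 0 < y < 1 -> q y < 1.
Proof.
move=> /andP[y0 y1]; rewrite /q /cs.
have -> : 2 * pi * y = (pi * y) *+ 2 by rewrite -mulrA mulr2n; lra.
rewrite cos_mulr2n.
have : 0 < sin (pi * y).
  apply: sin_gt0_pi; rewrite mulr_gt0//= ?pi_gt0// -[ltRHS]mulr1.
  by rewrite ltr_pM2l ?pi_gt0.
have := cos2Dsin2 (pi * y); rewrite mulr2n; nra.
Qed.

Let qD1 y : q (y + 1) = q y.
Proof. by rewrite /q /cs mulrDr mulr1 (_ : 2 * pi = pi *+ 2) ?cosD2pi// mulr2n; lra. Qed.

Let snD1 y : sn (y + 1) = sn y.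
Proof. by rewrite /sn mulrDr mulr1 (_ : 2 * pi = pi *+ 2) ?sinD2pi// mulr2n; lra. Qed.

(** The right-hand side is multiplied by (2n + 3) / (2n + 2) from n to n + 1. Normalizing the kernel
    thus costs at most a factor 2n + 1, which the geometric decay of [q ^+ n] absorbs. *)
Lemma kmean_ge n : 1 <= (2 * n + 1)%:R * kmean n.
Proof.
elim: n => [|n IH] /=; first by rewrite mulr1.
have h : (2 * n.+1 + 1)%:R = (2 * n + 2)%:R + 1 :> R by rewrite mulnS natrD; lra.
have h0 : 0 < (2 * n + 2)%:R :> R by rewrite ltr0n addn_gt0 orbT.
rewrite (_ : _ * _ = (2 * n + 1)%:R * kmean n * ((2 * n.+1 + 1)%:R / (2 * n + 2)%:R));
  last by ring.
apply: (le_trans IH); rewrite ler_peMr ?(le_trans ler01)//.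
rewrite ler_pdivlMr// mul1r h; lra.
Qed.

Lemma kprimD1 n y : kprim n (y + 1) = kprim n y.
Proof. by elim: n => //= n ->; rewrite qD1 snD1. Qed.

Lemma kprim_half n : kprim n (1 / 2) = 0.
Proof.
elim: n => //= n ->; rewrite /sn (_ : 2 * pi * (1 / 2) = pi); last by field.
by rewrite sinpi !mulr0 addr0.
Qed.

Lemma is_derive_kprim n y : is_derive y 1 (kprim n) (q y ^+ n - kmean n).
Proof.
elim: n => [|n IH].
  by rewrite expr0 subrr; exact: is_derive_cst.
have qd : is_derive y 1 q (- (pi * sn y)).
  have h : is_derive y 1 (fun x : R => (cst 1 x + cs x) * 2^-1) (- (pi * sn y)).
    apply: is_derive_eq.
    by rewrite /cst /GRing.scale /sn/=; field.
  exact: h.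
have /= := @is_deriveD _ _ _ _ _ _ _ _ _
  (@is_deriveZ _ _ _ _ ((2 * n + 1)%:R / (2 * n + 2)%:R : R) _ _ _ IH)
  (@is_deriveZ _ _ _ _ ((4 * pi * n.+1%:R)^-1 : R) _ _ _
    (@is_deriveM _ _ _ _ _ _ _ _ (@is_deriveX _ _ q n _ _ _ qd) (is_derive_sn y))).
have -> : (q ^+ n * sn : R -> R) = (fun y0 => q y0 ^+ n * sn y0).
  by apply/funext => z; rewrite fctE exprfctE.
congr (is_derive _ _ _ _); rewrite /GRing.scale/= exprfctE.
have sn2 : sn y * sn y = 4 * q y * (1 - q y).
  by have := cos2Dsin2 (2 * pi * y); rewrite /q /cs /sn => h; nra.
have cs2 : cs y = 2 * q y - 1 by rewrite /q; lra.
have pi0 : pi != 0 :> R by rewrite gt_eqF// pi_gt0.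
(* For n = 0 the factor n vanishes; otherwise sn^2 = 4 q (1 - q) restores the power of q lost by
   differentiation. *)
have -> : sn y * (n%:R * q y ^+ n.-1 * - (pi * sn y)) =
    - pi * n%:R * (4 * (1 - q y)) * q y ^+ n.
  case: (n) => [|m] /=; first by rewrite mulr0n; ring.
  transitivity (- pi * m.+1%:R * (sn y * sn y) * q y ^+ m).
    by ring.
  by rewrite sn2 exprS/=; ring.
rewrite cs2 exprS !natrD !addr0 -natr1.
have n0 : 0 <= n%:R :> R by [].
have n2 : n%:R + n%:R + 2 != 0 :> R by rewrite gt_eqF//; lra.
have n1 : 1 + n%:R != 0 :> R by rewrite gt_eqF//; lra.
move: (q y ^+ n) (q y) (kmean n) pi0 => qn qy k.
generalize (pi : R) => p p0.
by field; exact/and3P.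
Qed.

Lemma trig_kprim n a : trig_poly (fun x => kprim n (a - x)).
Proof.
elim: n => [|n IH] /=; first exact: trig_cst.
apply: trig_add; apply: trig_mul => //; try exact: trig_cst.
apply: trig_mul; last exact: trig_sin.
elim: {IH} n => [|n IH]; first exact: trig_cst.
under eq_fun do rewrite exprS.
apply: trig_mul => //; apply: trig_mul; last exact: trig_cst.
by apply: trig_add; [exact: trig_cst|exact: trig_cos].
Qed.

(** An approximate identity concentrating at the integers. Its primitive [step n] gains one over
    each period and tends to a staircase with values 1/2 on ]0, 1[ and -1/2 on ]-1, 0[; a difference
    of two reflected steps is a smooth periodic substitute for an indicator function. *)
Let kernel n y : R := q y ^+ n / kmean n.
Let step n y : R := y + kprim n y / kmean n.

Let kmean_gt0 n : 0 < kmean n.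
Proof.
have := kmean_ge n; have : 0 < (2 * n + 1)%:R :> R by rewrite ltr0n addn1.
by move=> h h1; rewrite -(pmulr_rgt0 _ h) (lt_le_trans _ h1).
Qed.

Let is_derive_step n y : is_derive y 1 (step n) (kernel n y).
Proof.
have /= := @is_deriveD _ _ _ _ _ _ _ _ _ (@is_derive_id _ _ y 1)
  (@is_deriveZ _ _ _ _ ((kmean n)^-1 : R) _ _ _ (is_derive_kprim n y)).
congr (is_derive _ _ _ _).
  by apply/funext => z; rewrite /step fctE /= mulrC.
by rewrite /kernel /GRing.scale/=; field; exact: lt0r_neq0.
Qed.

Let stepD1 n y : step n (y + 1) = step n y + 1.
Proof. by rewrite /step kprimD1 addrAC. Qed.

Let step_half n : step n (1 / 2) = 1 / 2.
Proof. by rewrite /step kprim_half mul0r addr0. Qed.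

Let kernel_ge0 n y : 0 <= kernel n y.
Proof. by rewrite divr_ge0 ?exprn_ge0// ltW. Qed.

Let continuous_step n : continuous (step n).
Proof.
by apply: derivable_continuous => x; exact: (@ex_derive _ _ _ _ _ _ _ (is_derive_step n x)).
Qed.

Let continuous_q : continuous q.
Proof.
move=> x; apply: cvgM; last exact: cvg_cst.
apply: cvgD; first exact: cvg_cst.
apply/differentiable_continuous/derivable1_diffP.
exact: (@ex_derive _ _ _ _ _ _ _ (is_derive_cs x)).
Qed.

Let continuous_kernel n : continuous (kernel n).
Proof.
move=> x; apply: cvgM; last exact: cvg_cst.
elim: n => [|n IH]; first by under eq_fun do rewrite expr0; exact: cvg_cst.
under eq_fun do rewrite exprS.
by rewrite exprS; apply: cvgM => //; exact: continuous_q.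
Qed.

(** On [d, 1 - d] the maximum of q is some s^2 < 1, so the kernel is at most (2n + 1) s^(2n). One
    factor s^n absorbs 2n + 1 and the other remains as a geometric sequence. *)
Let kernel_bound d : 0 < d -> exists e : nat -> R, e n @[n --> \oo] --> 0 /\
  forall n y, d <= y <= 1 - d -> kernel n y <= e n.
Proof.
move=> d0; have [dd|dd] := leP d (1 - d); last first.
  exists (fun=> 0); split => [|n y /andP[dy yd]]; first exact: cvg_cst.
  by have := lt_le_trans dd (le_trans dy yd); rewrite ltxx.
have [c cd qc] := EVT_max dd (continuous_subspaceT continuous_q).
have qc1 : q c < 1.
  by apply: q_lt1; move: cd; rewrite in_itv/= => /andP[? ?]; apply/andP; split; lra.
pose s := Num.sqrt (q c).
have s0 : 0 <= s by exact: sqrtr_ge0.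
have ss : s ^+ 2 = q c by rewrite sqr_sqrtr.
have s1 : s < 1 by rewrite -sqrtr1 ltr_sqrt.
(* This bounds n s^n by 1 / (1 - s): indeed 1 - s^n = (1 - s) (1 + s + ... + s^(n-1)) is at least n
   (1 - s) s^n. *)
have ns n : n%:R * (1 - s) * s ^+ n + s ^+ n <= 1.
  elim: n => [|n IH]; first by rewrite !mul0r expr0 add0r.
  have sn0 : 0 <= s ^+ n by rewrite exprn_ge0.
  have sn1 : s ^+ n <= 1 by rewrite exprn_ile1// ltW.
  have h1 : s * (n%:R * (1 - s) * s ^+ n + s ^+ n) <= s * 1 by rewrite ler_wpM2l.
  have h2 : s * (1 - s) * s ^+ n <= s * (1 - s) * 1.
    by rewrite ler_wpM2l// mulr_ge0// subr_ge0 ltW.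
  have h3 : 0 <= (1 - s) ^+ 2 by exact: sqr_ge0.
  rewrite exprS -natr1; lra.
exists (geometric (2 / (1 - s) + 1) s); split.
  by apply: cvg_geometric; rewrite ger0_norm.
move=> n y yd; rewrite /kernel ler_pdivrMr//=.
have qyc : q y ^+ n <= q c ^+ n by rewrite lerXn2r ?nnegrE//; exact: qc.
apply: (le_trans qyc); rewrite -ss -exprM mulnC exprM.
have sn0 : 0 <= s ^+ n by rewrite exprn_ge0.
have h : (2 * n + 1)%:R * s ^+ n <= 2 / (1 - s) + 1.
  have sn1 : s ^+ n <= 1 by rewrite exprn_ile1// ltW.
  rewrite natrD natrM mulrDl mul1r lerD// ler_pdivlMr ?subr_gt0//.
  by have := ns n; nra.
have h' := kmean_ge n; have kn := kmean_gt0 n.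
rewrite expr2 mulrAC ler_wpM2r//.
apply: (@le_trans _ _ ((2 * n + 1)%:R * kmean n * s ^+ n)).
  by rewrite ler_peMl.
by rewrite mulrAC ler_wpM2r// ltW.
Qed.

(** Every [step n] takes the value 1/2 exactly at 1/2, and between y and 1/2 its derivative, the
    kernel, tends to 0 uniformly. *)
Let step_cvg y : 0 < y < 1 -> step n y @[n --> \oo] --> (1 / 2 : R).
Proof.
move=> /andP[y0 y1].
pose d := Num.min y (1 - y).
have d0 : 0 < d by rewrite lt_min y0 subr_gt0.
have dy : d <= y by rewrite ge_min lexx.
have dy1 : d <= 1 - y by rewrite ge_min lexx orbT.
have [e [e0 he]] := kernel_bound d0.
apply/cvgrPdist_lt => eps eps0.
near=> n.
have en : e n < eps.
  apply: (le_lt_trans (ler_norm _)).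
  near: n; move/cvgr0Pnorm_lt : e0; exact.
apply: le_lt_trans en.
rewrite -[X in X - _](step_half n).
have [yh|/ltW yh] := leP y (1 / 2).
  have [c] := MVT_segment yh (fun x _ => is_derive_step n x)
    (continuous_subspaceT (@continuous_step n)).
  rewrite in_itv/= => /andP[yc ch] ->.
  rewrite ger0_norm; last by rewrite mulr_ge0// subr_ge0.
  have := he n c; have := kernel_ge0 n c.
  have -> : d <= c <= 1 - d by apply/andP; split; lra.
  move=> k0 /(_ isT); nra.
have [c] := MVT_segment yh (fun x _ => is_derive_step n x)
  (continuous_subspaceT (@continuous_step n)).
rewrite in_itv/= => /andP[yc ch]; rewrite distrC => ->.
rewrite ger0_norm; last by rewrite mulr_ge0// subr_ge0.
have := he n c; have := kernel_ge0 n c.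
have -> : d <= c <= 1 - d by apply/andP; split; lra.
move=> k0 /(_ isT); nra.
Unshelve. all: by end_near. Qed.

Let step_cvgN y : -1 < y < 0 -> step n y @[n --> \oo] --> (- (1 / 2) : R).
Proof.
move=> y01; rewrite (_ : - (1 / 2) = 1 / 2 - 1 :> R); last by lra.
rewrite (_ : (fun n => _) = (fun n => step n (y + 1) - 1)).
  apply: cvgB; last exact: cvg_cst.
  by apply: step_cvg; lra.
by apply/funext => n; rewrite stepD1 addrK.
Qed.

Let step_homo n x y : x <= y -> step n x <= step n y.
Proof.
move=> xy; rewrite -subr_ge0.
have [c _ ->] := MVT_segment xy (fun x _ => is_derive_step n x)
  (continuous_subspaceT (@continuous_step n)).
by rewrite mulr_ge0 ?subr_ge0.
Qed.

Lemma L2_integrable g : L2 g -> itv_integrable 0 1 g.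
Proof.
move=> [_ mg g2]; apply: (itv_integrable_le mg
  (itv_integrableD (itv_integrable_cst 0 1 1) g2)) => x _.
rewrite ler_norml; apply/andP; split; nra.
Qed.

Let is_derive_step_reflect n b y :
  is_derive y 1 (fun y => step n (b - y)) (- kernel n (b - y)).
Proof. exact: is_derive_reflect. Qed.

Let continuous_kernel_reflect n b : continuous (fun y => kernel n (b - y)).
Proof.
move=> y; apply: (@continuous_comp _ _ _ (fun y => b - y) (kernel n)).
  by apply: cvgB; [exact: cvg_cst|exact: cvg_id].
exact: continuous_kernel.
Qed.

Let int_kernel n b : itv_int 0 1 (fun y => kernel n (b - y)) = 1.
Proof.
have [_ /(_ 0 1)] : primitive (fun y => - step n (b - y)) (fun y => kernel n (b - y)).
  apply: primitive_derive => // y.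
  rewrite -[X in is_derive _ _ _ X]opprK; exact/is_deriveN/is_derive_step_reflect.
rewrite lexx ler01 subr0 => <- //.
by rewrite -[in X in - _ - - X](subrK 1 b) stepD1; lra.
Qed.

(** The integral of the kernel is 1, so f b can be moved under the integral; then |f y - f b| is
    small near b, and elsewhere it is bounded while the kernel is uniformly small. *)
Let kernel_cvg f b : continuous f -> 0 < b < 1 ->
  itv_int 0 1 (fun y => f y * kernel n (b - y)) @[n --> \oo] --> f b.
Proof.
move=> fc /andP[b0 b1].
have [B fB] : exists B, forall y, 0 <= y <= 1 -> `|f y - f b| <= B.
  have [|c _ fB] := @EVT_max _ (fun y => `|f y - f b|) 0 1 ler01.
    apply: continuous_subspaceT => x; apply: cvg_norm.
    by apply: cvgB; [exact: fc|exact: cvg_cst].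
  by exists `|f c - f b| => y y01; apply: fB; rewrite in_itv.
have B0 : 0 <= B by apply: le_trans (fB b _); rewrite ?normr_ge0// !ltW.
apply/cvgrPdist_lt => eps eps0.
have eps2 : 0 < eps / 2 by rewrite divr_gt0.
have /cvgrPdist_lt/(_ _ eps2)/nbhs_ballP[d' /= d'0 hd'] := fc b.
pose d := Num.min d' (Num.min b (1 - b)).
have d0 : 0 < d by rewrite !lt_min d'0 b0 subr_gt0.
have dd' : d <= d' by rewrite ge_min lexx.
have db : d <= b by rewrite !ge_min lexx orbT.
have db1 : d <= 1 - b by rewrite !ge_min lexx !orbT.
have [e [e0 he]] := kernel_bound d0.
near=> n.
have en : (B + 1) * e n < eps / 2.
  rewrite -ltr_pdivlMl ?ltr_wpDl//; apply: (le_lt_trans (ler_norm _)).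
  near: n; move/cvgr0Pnorm_lt : e0; apply.
  by rewrite mulr_gt0// invr_gt0 ltr_wpDl.
have ik : itv_integrable 0 1 (fun y => kernel n (b - y)).
  exact: itv_integrable_cont.
have ifk : itv_integrable 0 1 (fun y => f y * kernel n (b - y)).
  exact: itv_integrableM.
have fbE : f b = itv_int 0 1 (fun y => f b * kernel n (b - y)).
  by rewrite itv_intZ// int_kernel mulr1.
rewrite distrC [X in _ - X]fbE -itv_intB//; last first.
  exact: itv_integrableZ.
have i1 : itv_integrable 0 1 (fun y => f y * kernel n (b - y) - f b * kernel n (b - y)).
  by apply: itv_integrableB => //; exact: itv_integrableZ.
apply: (le_lt_trans (ler_norm_itv_int i1)).
apply: (@le_lt_trans _ _ (itv_int 0 1 (fun y => eps / 2 * kernel n (b - y) + B * e n))).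
  apply: le_itv_int; first exact: itv_integrable_norm.
    by apply: itv_integrableD; [exact: itv_integrableZ|exact: itv_integrable_cst].
  move=> y /andP[y0 y1].
  have k0 := kernel_ge0 n (b - y).
  rewrite -mulrBl normrM (ger0_norm k0).
  have e0n : 0 <= e n.
    apply: le_trans (he n d _); first exact: kernel_ge0.
    by apply/andP; split; lra.
  have [yd|yd] := ltP `|b - y| d.
    rewrite -[leLHS]addr0 lerD ?mulr_ge0//; apply: ler_wpM2r => //.
    rewrite distrC ltW//; apply: hd'; exact: lt_le_trans dd'.
  rewrite -[leLHS]add0r lerD//; first by rewrite mulr_ge0// ltW.
  apply: ler_pM => //; first by apply: fB; rewrite y0.
  have [yb|yb] := leP y b.
    apply: he; rewrite ger0_norm ?subr_ge0// in yd.
    by apply/andP; split; lra.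
  (* Here b - y is negative; adding one period brings it into [d, 1 - d]. *)
  rewrite -(addrK 1 (b - y)) addrAC /kernel.
  have -> : b - y - 1 + 1 = b - y by lra.
  rewrite -[q (b - y)]qD1.
  apply: he; rewrite ltr0_norm ?subr_lt0// in yd.
  by apply/andP; split; lra.
rewrite itv_intD; [|exact: itv_integrableZ|exact: itv_integrable_cst].
rewrite itv_intZ// int_kernel itv_int_cst ?ler01//.
have : 0 <= e n.
  apply: le_trans (he n d _); first exact: kernel_ge0.
  by apply/andP; split; lra.
lra.
Unshelve. all: by end_near. Qed.

(** The weak derivative is tested with [psi n], which approximates the indicator of [a, b]. Its
    derivative is the kernel at a minus the kernel at b, so one side tends to f b - f a; the other
    tends to the integral of g over [a, b] by dominated convergence. *)
Let weak_deriv_increment_interior f g a b : continuous f -> L2 g ->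
  weak_deriv f g -> 0 < a -> a < b -> b < 1 -> f b - f a = itv_int a b g.
Proof.
move=> fc gL fg a0 ab b1.
have gi := L2_integrable gL.
pose psi n y := step n (b - y) - step n (a - y).
have psi_trig n : trig_poly (psi n).
  (* The linear parts of the two steps cancel up to the constant b - a, which leaves a trigonometric
     polynomial. *)
  rewrite (_ : psi n = fun y => (b - a) + ((kmean n)^-1 * kprim n (b - y) +
                                 - (kmean n)^-1 * kprim n (a - y))).
    apply: trig_add; first exact: trig_cst.
    by apply: trig_add; apply: trig_mul; (exact: trig_cst || exact: trig_kprim).
  by apply/funext => y; rewrite /psi /step; ring.
have dpsi n y : is_derive y 1 (psi n) (- kernel n (b - y) - - kernel n (a - y)).
  exact: (is_deriveB (is_derive_step_reflect n b y) (is_derive_step_reflect n a y)).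
have psi_cont n : continuous (psi n).
  by apply: derivable_continuous => x; exact: (@ex_derive _ _ _ _ _ _ _ (dpsi n x)).
have E n : itv_int 0 1 (fun y => psi n y * g y) =
  itv_int 0 1 (fun y => f y * kernel n (b - y)) -
  itv_int 0 1 (fun y => f y * kernel n (a - y)).
  have := fg _ (trig_poly_test (psi_trig n)).
  rewrite /dist_dx /dist_of /circle_int -/(itv_int _ _ _) -/(itv_int _ _ _).
  have -> : (fun x => g x * psi n x) = (fun y => psi n y * g y).
    by apply/funext => y; rewrite mulrC.
  move=> <-.
  have kf c : itv_integrable 0 1 (fun y => f y * kernel n (c - y)).
    by apply: itv_integrableM => //; exact: itv_integrable_cont.
  rewrite -itv_intB// -mulN1r -itv_intZ; last first.
    apply: itv_integrableM => //; apply: itv_integrable_cont.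
    rewrite (_ : derive1 _ = (fun y => - kernel n (b - y) - - kernel n (a - y))).
      by move=> x; apply: cvgB; apply: cvgN; exact: continuous_kernel_reflect.
    by apply/funext => y; rewrite derive1E; apply: (@derive_val _ _ _ _ _ _ _ (dpsi n y)).
  apply: eq_itv_int => y _.
  rewrite derive1E (@derive_val _ _ _ _ _ _ _ (dpsi n y)); ring.
have L1 : itv_int 0 1 (fun y => psi n y * g y) @[n --> \oo] --> f b - f a.
  under eq_fun do rewrite E.
  apply: cvgB; apply: kernel_cvg => //.
    by rewrite (lt_trans a0 ab).
  by rewrite a0 (lt_trans ab b1).
suff L2 : itv_int 0 1 (fun y => psi n y * g y) @[n --> \oo] --> itv_int a b g.
  exact: (cvg_unique _ L1 L2).
have mg : measurable_fun [set: R] g by case: gL.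
have psig n : itv_integrable 0 1 (fun y => psi n y * g y) by exact: itv_integrableM.
have [||||||gab _ dct] := @dominated_convergence _ _ _ (@lebesgue_measure R)
    `[0, 1]%classic _ (fun n => EFin \o (fun y => psi n y * g y))
    (EFin \o (g \_ `[a, b])) (EFin \o (fun y => `|g y|)).
- by [].
- by move=> n; exact: (measurable_int _ (psig n)).
- apply/measurable_EFinP; apply: measurable_funS (@measurableT _ _) _ _ => //.
  by apply: (measurable_restrictT _ _).1 => //; exact: measurable_funS mg.
(* At a and b the limit of [psi n] is 1/2 and not 1, so these two points form the exceptional null
   set. *)
- exists [set a; b]; split => //.
    by exact: measurableU.
    by apply: countable_lebesgue_measure0; exact/finite_set_countable/finite_set2.
  move=> y /=; apply: contra_notP => /not_orP[ya yb].
  rewrite in_itv/= => /andP[y0 y1]; apply: cvg_EFin; first exact: nearW.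
  rewrite /comp /= patchE.
  have {}ya : y < a \/ a < y by case: (ltgtP y a) => [|| /ya]//; [left|right].
  have {}yb : y < b \/ b < y by case: (ltgtP y b) => [|| /yb]//; [left|right].
  have S c : y < c -> c < 1 -> step n (c - y) @[n --> \oo] --> (1 / 2 : R).
    by move=> yc c1; apply: step_cvg; lra.
  have S' c : c < y -> 0 < c -> step n (c - y) @[n --> \oo] --> (- (1 / 2) : R).
    by move=> yc c1; apply: step_cvgN; lra.
  case: ya => ya; [|case: yb => yb].
  - rewrite memNset /=; last by rewrite in_itv/= leNgt ya.
    rewrite [X in _ --> X](_ : _ = (1 / 2 - 1 / 2) * g y); last by rewrite subrr mul0r.
    by apply: cvgM; [apply: cvgB; apply: S; lra|exact: cvg_cst].
  - rewrite mem_set /=; last by rewrite in_itv/= !ltW.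
    rewrite -[X in _ --> X]mul1r (_ : 1 = 1 / 2 - - (1 / 2)); last by lra.
    by apply: cvgM; [apply: cvgB; [apply: S|apply: S']|exact: cvg_cst].
  - rewrite memNset /=; last by rewrite in_itv/= (leNgt y b) yb andbF.
    rewrite [X in _ --> X](_ : _ = (- (1 / 2) - - (1 / 2)) * g y); last by rewrite subrr mul0r.
    by apply: cvgM; [apply: cvgB; apply: S'; lra|exact: cvg_cst].
- exact: itv_integrable_norm.
(* Monotonicity of the steps gives psi >= 0; with b <= a + 1 and [stepD1] it also gives psi <= 1. *)
- apply: aeW => y n _; rewrite /= lee_fin normrM ler_piMl//.
  rewrite ger0_norm /psi ?subr_ge0 ?step_homo// ?lerB ?(ltW ab)//.
  rewrite lerBlDr [leRHS]addrC -stepD1 step_homo//; lra.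
- have -> : itv_int a b g =
      fine (\int[lebesgue_measure]_(x in `[0, 1]) (EFin \o g \_ `[a, b]) x).
    rewrite -/(Rintegral _ _ _) -Rintegral_mkcondr /itv_int; congr Rintegral.
    apply/seteqP; split => y /=; rewrite !in_itv/=.
      by move=> /andP[ay yb]; rewrite ay yb !(le_trans (ltW a0))// (le_trans yb)// ltW.
    by case.
  have gfin := integrable_fin_num _ gab.
  by apply: fine_cvg; rewrite fineK ?gfin.
Qed.

(** By the interior case, f minus the indefinite integral of g is constant on ]0, 1[; being
    continuous on [0, 1], it keeps this value at both ends. *)
Lemma primitive_weak_deriv f g : continuous f -> L2 g ->
  weak_deriv f g -> primitive f g.
Proof.
move=> fc gL fg; have gi := L2_integrable gL; split => //.
pose H y := f y - itv_int 0 y g.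
have Hc : {within `[0, 1], continuous H}.
  have := parameterized_integral_continuous ler01 gi.
  move=> pc x; apply: cvgB; [exact: (continuous_subspaceT fc)|exact: pc].
have Hinc y z : 0 < y -> y <= z -> z < 1 -> H y = H z.
  move=> y0; rewrite le_eqVlt => /predU1P[->//|yz] z1.
  have := weak_deriv_increment_interior fc gL fg y0 yz z1.
  rewrite /H.
  rewrite (@itv_int_split _ 0 y z) ?ltW//; first lra.
  by apply: itv_integrableS gi => //; exact: ltW.
have Hhalf y : 0 < y -> y < 1 -> H y = H (1 / 2).
  move=> y0 y1; have [yh|/ltW yh] := leP y (1 / 2).
    by apply: Hinc => //; lra.
  by apply/esym; apply: Hinc => //; lra.
have [_ H0 H1] := (continuous_within_itvP _ ltr01).1 Hc.
have H0E : H 0 = H (1 / 2).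
  suff H0' : H y @[y --> 0^'+] --> H (1 / 2) by exact: (cvg_unique _ H0 H0').
  apply: cvg_near_cst; near=> y.
  by apply: Hhalf; near: y; [exact: nbhs_right_gt|exact: nbhs_right_lt].
have H1E : H 1 = H (1 / 2).
  suff H1' : H y @[y --> 1^'-] --> H (1 / 2) by exact: (cvg_unique _ H1 H1').
  apply: cvg_near_cst; near=> y.
  by apply: Hhalf; near: y; [exact: nbhs_left_gt|exact: nbhs_left_lt].
have HE y : 0 <= y -> y <= 1 -> H y = H (1 / 2).
  rewrite le_eqVlt => /predU1P[<-//|y0].
  by rewrite le_eqVlt => /predU1P[->//|y1]; exact: Hhalf.
move=> s t s0 st t1.
have := HE s s0 (le_trans st t1); rewrite -(HE t (le_trans s0 st) t1).
rewrite /H.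
rewrite (@itv_int_split _ 0 s t)//; first lra.
exact: itv_integrableS gi.
Unshelve. all: by end_near. Qed.

End trigonometric_kernel.

(** * Gluing of primitives, and uniqueness of weak derivatives *)

Section weak_derivatives.
Context {R : realType}.
Implicit Types (a b r x y : R) (f g F G v : R -> R).
Local Notation mu := (@lebesgue_measure R).

Lemma itv_integrable_bdM a b (B : R) f g : measurable_fun [set: R] f ->
  (forall x, `|f x| <= B) -> itv_integrable a b g ->
  itv_integrable a b (fun x => f x * g x).
Proof.
move=> mf fB gi.
apply: (@integrableMr _ _ _ mu `[a, b]%classic _ f (EFin \o g)) => //.
  exact: measurable_funS mf.
exists B; split; rewrite ?num_real // => M BM x _ /=.
by rewrite (le_trans (fB x))// ltW.
Qed.

Lemma eq_itv_int_co a b f g : itv_integrable a b f -> itv_integrable a b g ->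
  (forall x, a <= x < b -> f x = g x) -> itv_int a b f = itv_int a b g.
Proof.
move=> fi gi fg; rewrite /itv_int -!Rintegral_itv_bndo_bndc.
- by apply: eq_Rintegral => x; rewrite inE/= in_itv/= => /fg.
- by apply: integrableS gi => //; apply: subset_itv; rewrite bnd_simp.
- by apply: integrableS fi => //; apply: subset_itv; rewrite bnd_simp.
Qed.

(** Meant for a derivative that jumps at r and takes its right-hand value there; on the left,
    agreement on [0, r[ suffices because a point is negligible. *)
Lemma primitive_piecewise r F1 f1 F2 f2 f : 0 <= r <= 1 ->
  primitive F1 f1 -> primitive F2 f2 -> F1 r = F2 r -> itv_integrable 0 1 f ->
  (forall x, 0 <= x < r -> f x = f1 x) ->
  (forall x, r <= x <= 1 -> f x = f2 x) ->
  primitive (fun x => if x <= r then F1 x else F2 x) f.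
Proof.
move=> /andP[r0 r1] [f1i Ff1] [f2i Ff2] F12 fi ff1 ff2; split => //.
have L s t : 0 <= s -> s <= t -> t <= r -> F1 t - F1 s = itv_int s t f.
  move=> s0 st tr; rewrite Ff1//; last exact: le_trans r1.
  apply: eq_itv_int_co.
  - by apply: itv_integrableS f1i => //; exact: le_trans r1.
  - by apply: itv_integrableS fi => //; exact: le_trans r1.
  - move=> x /andP[sx xt]; rewrite ff1//.
    by rewrite (le_trans s0)//= (lt_le_trans xt).
have U s t : r <= s -> s <= t -> t <= 1 -> F2 t - F2 s = itv_int s t f.
  move=> rs st t1; rewrite Ff2//; last exact: le_trans rs.
  apply: eq_itv_int => x /andP[sx xt]; rewrite ff2//.
  by rewrite (le_trans rs)//= (le_trans xt).
move=> s t s0 st t1.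
have [tr|rt] := leP t r; first by rewrite (le_trans st tr) L.
have [sr|/ltW rs] := leP s r; last by rewrite U.
rewrite (@itv_int_split _ s r t)//; last first.
- exact: itv_integrableS fi.
- exact: ltW.
by rewrite -L// -U ?(ltW rt)// F12; lra.
Qed.

(** Integration by parts: the increment of f psi over a period is zero. *)
Lemma weak_deriv_primitive f g : periodic f 1 -> continuous f -> L2 g ->
  primitive f g -> weak_deriv f g.
Proof.
move=> fp fc gL fg psi [psip psid].
have psi1 x : is_derive x 1 psi (derive1 psi x).
  by rewrite derive1E; apply: derivableP; exact: (psid 0%N).
have dc h : (forall x, derivable h x 1) -> continuous h.
  by move=> hd x; apply/differentiable_continuous/derivable1_diffP.
have psic : continuous psi by apply: dc => x; exact: (psid 0%N).
have psi1c : continuous (derive1 psi) by apply: dc => x; exact: (psid 1%N).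
have [_ /(_ 0 1 (lexx _) ler01 (lexx _))] :=
  primitiveM fc psic fg (primitive_derive psi1 psi1c).
have -> : f 1 = f 0 by rewrite -[in LHS](add0r 1) fp.
have -> : psi 1 = psi 0 by rewrite -[in LHS](add0r 1) psip.
rewrite subrr.
rewrite itv_intD; last 2 first.
- by apply: itv_integrableM => //; exact: L2_integrable.
- by apply: itv_integrableM => //; exact: itv_integrable_cont.
rewrite /dist_dx /dist_of /circle_int -!/(itv_int _ _ _).
have -> : (fun x => psi x * g x) = (fun x => g x * psi x).
  by apply/funext => x; rewrite mulrC.
lra.
Qed.

(** The integrals of f - g over all [0, y] vanish, so f = g almost everywhere by Lebesgue
    differentiation. This frees [H1norm] from the representative picked by [wderiv]. *)
Lemma primitive_unique F f g : measurable_fun [set: R] f ->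
  measurable_fun [set: R] g -> primitive F f -> primitive F g ->
  itv_int 0 1 (fun x => f x ^+ 2) = itv_int 0 1 (fun x => g x ^+ 2).
Proof.
move=> mf mg [fi Ff] [gi Fg].
(* Extension by zero turns integrals over [0, y] into integrals over ]-oo, y], to which [FTC1Ny]
   applies. *)
pose k := (fun x => f x - g x) \_ `[0, 1].
have ki : mu.-integrable setT (EFin \o k).
  rewrite /k -restrict_EFin; apply/integrable_restrict => //.
  by rewrite setTI; exact: itv_integrableB.
have kl : locally_integrable [set: R] k.
  by apply: open_integrable_locally => //; exact: openT.
have kiy y : mu.-integrable `]-oo, y] (EFin \o k).
  by apply: integrableS ki.
have K0 y : 0 <= y <= 1 -> \int[mu]_(t in `]-oo, y]) k t = 0.
  move=> /andP[y0 y1]; rewrite /k -Rintegral_mkcondr.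
  have -> : `]-oo, y] `&` `[0, 1] = `[0, y]%classic :> set R.
    apply/seteqP; split => x /=; rewrite !in_itv/=; first by case=> -> /andP[->].
    by move=> /andP[x0 xy]; rewrite x0 xy (le_trans xy).
  have S h : itv_integrable 0 1 h -> itv_integrable 0 y h.
    exact: itv_integrableS.
  by rewrite -/(itv_int _ _ _) (itv_intB (S _ fi) (S _ gi)) -Ff// -Fg// subrr.
have k0 : {ae mu, forall x, 0 <= x <= 1 -> f x = g x}.
  have e0 : {ae mu, forall x, x != 0 /\ x != 1}.
    exists [set 0; 1]; split; first exact: measurableU.
      by apply: countable_lebesgue_measure0; exact/finite_set_countable/finite_set2.
    move=> x /=; apply: contra_notP => /not_orP[/eqP x0 /eqP x1]; exact: conj.
  move: e0 (FTC1Ny kiy kl); apply: filterS2.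
    exact: (ae_filter_ringOfSetsType mu).
  move=> x [x0 x1] [_ kx].
  rewrite le_eqVlt eq_sym (negbTE x0)/= le_eqVlt (negbTE x1)/= => /andP[{}x0 {}x1].
  suff : k x = 0.
    rewrite /k patchE mem_set/=; last by rewrite in_itv/= !ltW.
    by move/eqP; rewrite subr_eq0 => /eqP.
  rewrite -kx derive1E (@near_eq_derive _ _ _ _ (cst 0)) ?derive_cst//.
  near=> y; apply: K0; apply/andP; split; apply: ltW; near: y.
    exact: lt_nbhsr.
  exact: lt_nbhsl.
rewrite /itv_int /Rintegral; congr fine; apply: ae_eq_integral => //.
- by apply/measurable_EFinP; apply: measurable_funS (measurable_funX 2 mf).
- by apply/measurable_EFinP; apply: measurable_funS (measurable_funX 2 mg).
- move: k0; apply: filterS; first exact: (ae_filter_ringOfSetsType mu).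
  move=> x fgx /=; rewrite in_itv/= => /fgx ->//.
Unshelve. all: by end_near. Qed.

End weak_derivatives.

(** * The peakon profile, its derivative and its conserved quantities *)

Section peakon.
Context {R : realType}.
Implicit Types (x y xi : R) (f g v : R -> R).

Lemma periodic_intr v : periodic v 1 -> forall x (n : int), v (x + n%:~R) = v x.
Proof.
move=> vp x [n|n]; first exact: periodicn.
by rewrite NegzE rmorphN /= -[LHS](periodicn vp n.+1) -pmulrn subrK.
Qed.

Lemma periodic_itv v x : periodic v 1 -> exists2 y, 0 <= y <= 1 & v y = v x.
Proof.
move=> vp; exists (x - (Num.floor x)%:~R).
  by have := floor_itv x; rewrite intrD => /andP[h1 h2]; apply/andP; split; lra.
by rewrite -(periodic_intr vp _ (Num.floor x)) subrK.
Qed.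

(** A centred sawtooth of slope one that drops from 1/2 to -1/2 at xi modulo 1. Times 12/13, it is
    the derivative of the peakon with peak at xi. *)
Definition saw xi x : R := x - xi - (Num.floor (x - xi))%:~R - 2^-1.

Lemma phi_saw xi x : phi (x - xi + 2^-1) = 26^-1 * (12 * saw xi x ^+ 2 + 23).
Proof.
rewrite /phi /saw.
have -> : x - xi + 2^-1 + 2^-1 = x - xi + 1 by lra.
rewrite floorDrz ?int_num1// floor1 intrD.
by congr (_ * (_ * _ ^+ 2 + _)); lra.
Qed.

Lemma saw_bound xi x : - 2^-1 <= saw xi x <= 2^-1.
Proof.
by rewrite /saw; have := floor_itv (x - xi); rewrite intrD => /andP[h1 h2]; lra.
Qed.

Lemma saw_periodic xi : periodic (saw xi) 1.
Proof.
move=> x; rewrite /saw (_ : x + 1 - xi = x - xi + 1); last by lra.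
by rewrite floorDrz ?int_num1// floor1 intrD; lra.
Qed.

Lemma measurable_saw xi : measurable_fun [set: R] (saw xi).
Proof.
apply: measurable_funB => //; apply: measurable_funB.
  exact: measurable_funB.
apply: nondecreasing_measurable => // x y xy.
by rewrite ler_int le_floor// lerD2r.
Qed.

Lemma saw_L2 xi : L2 (saw xi).
Proof.
split; [exact: saw_periodic|exact: measurable_saw|].
apply: (itv_integrable_le (g := cst 1)) => [||x _].
- exact: measurable_funX (measurable_saw xi).
- exact: itv_integrable_cst.
- by have := saw_bound xi x; rewrite ger0_norm ?sqr_ge0// /cst; nra.
Qed.

(* The representative of the peak modulo 1 in ]0, 1]. *)
Let peak xi : R := xi - (Num.ceil xi - 1)%:~R.

Let peak_itv xi : 0 < peak xi <= 1.
Proof.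
by rewrite /peak; have := ceil_itv xi; rewrite intrD => /andP[h1 h2]; lra.
Qed.

Let saw_left xi x : 0 <= x < peak xi -> saw xi x = x - peak xi + 2^-1.
Proof.
move=> /andP[x0 xr]; have := peak_itv xi => /andP[p0 p1].
rewrite /saw (@floor_def _ _ (- Num.ceil xi)).
  by rewrite /peak intrD rmorphN /=; lra.
by move: xr p0 p1; rewrite /peak !intrD rmorphN /= => ? ? ?; apply/andP; split; lra.
Qed.

Let saw_right xi x : peak xi <= x <= 1 -> saw xi x = x - peak xi - 2^-1.
Proof.
move=> /andP[rx x1]; have := peak_itv xi => /andP[p0 p1].
rewrite /saw (@floor_def _ _ (1 - Num.ceil xi)).
  by rewrite /peak !intrD rmorphN /=; lra.
by move: rx p0 p1; rewrite /peak !intrD rmorphN /= => ? ? ?; apply/andP; split; lra.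
Qed.

(** Over a period the sawtooth sweeps [-1/2, 1/2] once with slope one. The primitives of the two
    affine branches are glued at the peak, the constant d in [shift] making them agree there. *)
Lemma itv_int_saw xi (P Q : R -> R) : (forall x, is_derive x 1 P (Q x)) ->
  continuous Q -> itv_int 0 1 (fun x => Q (saw xi x)) = P (2^-1) - P (- 2^-1).
Proof.
move=> PQ Qc; have /andP[p0 p1] := peak_itv xi; set r := peak xi in p0 p1.
have shift c d : primitive (fun x => P (x - r + c) + d) (fun x => Q (x - r + c)).
  apply: primitive_derive => x.
    rewrite -[X in is_derive _ _ _ X]addr0; apply: is_deriveD.
    have H : is_derive x 1 (fun x : R => x - r + c) 1.
      by apply: is_derive_eq; rewrite !(addr0, subr0).
    rewrite -[X in is_derive _ _ _ X]mulr1.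
    exact: (@is_derive1_comp _ P (fun x : R => x - r + c)).
  apply: (@continuous_comp _ _ _ (fun x : R => x - r + c) Q); last exact: Qc.
  by apply: cvgD; [apply: cvgB; [exact: cvg_id|exact: cvg_cst]|exact: cvg_cst].
have [B QB] : exists B, forall y, - 2^-1 <= y <= 2^-1 -> `|Q y| <= B.
  have [||c _ QB] := @EVT_max _ (fun y => `|Q y|) (- 2^-1) 2^-1.
  - lra.
  - by apply: continuous_subspaceT => x; apply: cvg_norm; exact: Qc.
  - by exists `|Q c| => y yh; apply: QB; rewrite in_itv.
have Qi : itv_integrable 0 1 (fun x => Q (saw xi x)).
  apply: (itv_integrable_le (g := cst B)) => [||x _].
  - apply: measurableT_comp (measurable_saw xi).
    exact: continuous_measurable_fun.
  - exact: itv_integrable_cst.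
  - by apply: QB; exact: saw_bound.
have r01 : 0 <= r <= 1 by rewrite ltW.
have [] := primitive_piecewise (f := fun x => Q (saw xi x)) r01 (shift (2^-1) 0)
  (shift (- 2^-1) (P (2^-1) - P (- 2^-1))) _ Qi.
- by rewrite /= subrr !add0r; lra.
- by move=> x xr; rewrite saw_left.
- by move=> x xr; rewrite saw_right.
move=> _ /(_ 0 1 (lexx _) ler01 (lexx _)) <-.
(* If the peak is at 1, the endpoint 1 belongs to the left branch. *)
rewrite (ltW p0); case: ifPn => [h|_].
  have -> : r = 1 by apply/eqP; rewrite eq_le p1.
  by rewrite subrr sub0r add0r (_ : - 1 + 2^-1 = - 2^-1); lra.
by rewrite (_ : 1 - r - 2^-1 = 0 - r + 2^-1); lra.
Qed.

Lemma primitive_phi xi : primitive (fun x => phi (x - xi + 2^-1))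
  (fun x => 12 / 13 * saw xi x).
Proof.
have /andP[p0 p1] := peak_itv xi; set r := peak xi in p0 p1.
have shift c : primitive (fun x => 26^-1 * (12 * (x - r + c) ^+ 2 + 23))
    (fun x => 12 / 13 * (x - r + c)).
  apply: primitive_derive => x.
    apply: is_derive_eq; rewrite /GRing.scale/=; lra.
  apply: cvgM; first exact: cvg_cst.
  by apply: cvgD; [apply: cvgB; [exact: cvg_id|exact: cvg_cst]|exact: cvg_cst].
have si : itv_integrable 0 1 (fun x => 12 / 13 * saw xi x).
  exact/itv_integrableZ/L2_integrable/saw_L2.
have r01 : 0 <= r <= 1 by rewrite ltW.
have [] := primitive_piecewise (f := fun x => 12 / 13 * saw xi x) r01 (shift (2^-1))
  (shift (- 2^-1)) _ si.
- by rewrite /= subrr !add0r sqrrN.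
- by move=> x xr; rewrite saw_left.
- by move=> x xr; rewrite saw_right.
move=> _ H; split => // s t s0 st t1; rewrite -H//.
have E x : 0 <= x -> x <= 1 -> phi (x - xi + 2^-1) =
    if x <= r then 26^-1 * (12 * (x - r + 2^-1) ^+ 2 + 23)
              else 26^-1 * (12 * (x - r - 2^-1) ^+ 2 + 23).
  move=> x0 x1; rewrite phi_saw; case: ltgtP => xr.
  - by rewrite saw_left ?x0.
  - by rewrite saw_right ?x1 ?(ltW xr).
  - by rewrite xr saw_right ?lexx ?p1// subrr !add0r sqrrN.
by rewrite !E// ?(le_trans st)// (le_trans s0).
Qed.

(** The distributional derivative of the sawtooth is 1 minus the Dirac mass at xi; integration by
    parts on each side of the peak gives the mean from the slope and v xi from the jump. *)
Lemma itv_int_saw_deriv xi v g : periodic v 1 -> continuous v -> primitive v g ->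
  itv_int 0 1 (fun x => saw xi x * g x) = v xi - itv_int 0 1 v.
Proof.
move=> vp vc vg; have /andP[p0 p1] := peak_itv xi; set r := peak xi in p0 p1.
have vxi : v xi = v r by rewrite -(periodic_intr vp r (Num.ceil xi - 1)) /r /peak subrK.
have lin c : continuous (fun x : R => x - r + c).
  move=> x.
  by apply: cvgD; [apply: cvgB; [exact: cvg_id|exact: cvg_cst]|exact: cvg_cst].
have shift c d : primitive (fun x => (x - r + c) * v x + d)
    (fun x => v x * 1 + (x - r + c) * g x).
  have [] := primitiveM (lin c) vc _ vg (f := fun=> 1).
    apply: primitive_derive => [x|]; last by move=> x; exact: cvg_cst.
    by apply: is_derive_eq; rewrite !(addr0, subr0).
  by move=> i H; split => // s t s0 st t1; rewrite -H//; lra.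
have gi := vg.1.
have vi : itv_integrable 0 1 v by exact: itv_integrable_cont.
have sgi : itv_integrable 0 1 (fun x => saw xi x * g x).
  apply: (itv_integrable_bdM (B := 2^-1) (measurable_saw xi)) => // x.
  by rewrite ler_norml saw_bound.
have r01 : 0 <= r <= 1 by rewrite ltW.
have [] := primitive_piecewise (f := fun x => v x + saw xi x * g x) r01
  (shift (2^-1) 0) (shift (- 2^-1) (v r)) _ (itv_integrableD vi sgi).
- by rewrite /= subrr; lra.
- by move=> x xr; rewrite saw_left// mulr1.
- by move=> x xr; rewrite saw_right// mulr1.
move=> _ /(_ 0 1 (lexx _) ler01 (lexx _)).
have v1 : v 1 = v 0 by rewrite -[in LHS](add0r 1) vp.
rewrite (ltW p0) itv_intD// v1 vxi; case: ifPn => [h|_]; last lra.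
have r1 : r = 1 by apply/eqP; rewrite eq_le p1.
by rewrite r1 v1; lra.
Qed.

Lemma itv_int_phi xi : itv_int 0 1 (fun x => phi (x - xi + 2^-1)) = 12 / 13.
Proof.
under eq_fun do rewrite phi_saw.
pose Q y : R := 26^-1 * (12 * y ^+ 2 + 23).
have PQ y : is_derive y 1 (fun y : R => 26^-1 * (4 * y ^+ 3 + 23 * y)) (Q y).
  by apply: is_derive_eq; rewrite /GRing.scale/= /Q; ring.
have Qc : continuous Q.
  by apply: derivable_continuous => x; exact: ex_derive.
by rewrite (itv_int_saw xi PQ Qc); field.
Qed.

Lemma itv_int_saw_sqr xi : itv_int 0 1 (fun x => saw xi x ^+ 2) = 12^-1.
Proof.
have PQ (y : R) : is_derive y 1 (fun y : R => 3^-1 * y ^+ 3) (y ^+ 2).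
  by apply: is_derive_eq; rewrite /GRing.scale/=; field.
have Qc : continuous (fun y : R => y ^+ 2).
  by apply: derivable_continuous => x; exact: ex_derive.
by rewrite (itv_int_saw xi PQ Qc); field.
Qed.

(** Twice H_2 at phi: 5768/6760 is the integral of phi^2, and 248/3120 that of phi times the squared
    sawtooth. *)
Definition peakon_ham2 : R := 24 / 13 * (5768 / 6760) + 144 / 169 * (248 / 3120).

Lemma itv_int_phi_ham2 xi :
  itv_int 0 1 (fun x => 24 / 13 * phi (x - xi + 2^-1) ^+ 2 +
    phi (x - xi + 2^-1) * (12 / 13 * saw xi x) ^+ 2) = peakon_ham2.
Proof.
under eq_fun do rewrite phi_saw.
pose Q y : R := 24 / 13 * (26^-1 * (12 * y ^+ 2 + 23)) ^+ 2 +
    26^-1 * (12 * y ^+ 2 + 23) * (12 / 13 * y) ^+ 2.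
have PQ y : is_derive y 1 (fun y => 24 / 13 * 676^-1 *
     (144 / 5 * y ^+ 5 + 184 * y ^+ 3 + 529 * y) +
   144 / 4394 * (12 / 5 * y ^+ 5 + 23 / 3 * y ^+ 3)) (Q y).
  by apply: is_derive_eq; rewrite /GRing.scale/= /Q; field.
have Qc : continuous Q.
  by apply: derivable_continuous => x; exact: ex_derive.
by rewrite (itv_int_saw xi PQ Qc) /peakon_ham2; field.
Qed.

End peakon.

(** * The inequality between the extrema and the conserved quantities *)

Section peak_inequality.
Context {R : realType}.
Implicit Types (x y xi : R) (f g v : R -> R).

(** The arc from a to b and the complementary arc, closed up by v 1 = v 0, each contribute |v b - v
    a| to the variation. *)
Lemma closed_variation_ge v g a b : v 1 = v 0 -> primitive v g ->
  0 <= a <= 1 -> 0 <= b <= 1 ->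
  2 * `|v b - v a| <= itv_int 0 1 (fun x => `|g x|).
Proof.
move=> v1 [gi vg].
wlog ab : a b / a <= b.
  move=> H a01 b01; have [ab|/ltW ba] := leP a b; first exact: H.
  by rewrite distrC; exact: H.
move=> /andP[a0 a1] /andP[b0 b1].
have S c d : 0 <= c -> c <= d -> d <= 1 ->
    `|v d - v c| <= itv_int c d (fun x => `|g x|).
  move=> c0 cd d1; rewrite vg//; apply: ler_norm_itv_int.
  exact: itv_integrableS gi.
have ni := itv_integrable_norm gi.
rewrite (itv_int_split a0 a1 ni) (itv_int_split ab b1); last first.
  exact: itv_integrableS ni.
have := S _ _ (lexx _) a0 a1; have := S _ _ a0 ab b1.
have := S _ _ b0 b1 (lexx _).
have : `|v b - v a| <= `|v a - v 0| + `|v 1 - v b|.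
  rewrite distrC v1 (_ : v a - v b = (v a - v 0) + (v 0 - v b)); last by ring.
  exact: ler_normD.
lra.
Qed.

Variables (m M : R).
(** The peakon with minimum m satisfies v_x^2 = 24/13 (v - m) = 16 r(v)^2. Hence [h] is M - y times
    the slope of that profile at height y, and [Psi] is its antiderivative, written in powers of r
    by means of y - m = 26/3 r^2. *)
Let r y : R := Num.sqrt (3 / 26 * (y - m)).
Let h y : R := 4 * (M - y) * r y.
Let Psi y : R := 208 / 3 * ((M - m) / 3 * r y ^+ 3 - 26 / 15 * r y ^+ 5).

Let r_ge0 y : 0 <= r y. Proof. exact: sqrtr_ge0. Qed.

Let r_sqr y : m <= y -> r y ^+ 2 = 3 / 26 * (y - m).
Proof. by move=> my; rewrite sqr_sqrtr// mulr_ge0// subr_ge0. Qed.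

Let affine_cont (a b : R) : continuous (fun y : R => a * (y - b)).
Proof. by apply: derivable_continuous => x; exact: ex_derive. Qed.

Let r_cont : continuous r.
Proof.
move=> x; apply: (@continuous_comp _ _ _ (fun y => 3 / 26 * (y - m)) Num.sqrt).
  exact: affine_cont.
exact: sqrt_continuous.
Qed.

Let h_cont : continuous h.
Proof.
have c : continuous (fun y => 4 * (M - y)).
  by apply: derivable_continuous => x; exact: ex_derive.
by move=> x; apply: cvgM; [exact: c|exact: r_cont].
Qed.

Let Psi_cont : continuous Psi.
Proof.
have c : continuous (fun z : R => 208 / 3 * ((M - m) / 3 * z ^+ 3 - 26 / 15 * z ^+ 5)).
  by apply: derivable_continuous => x; exact: ex_derive.
move=> x; apply: (@continuous_comp _ _ _ r
  (fun z => 208 / 3 * ((M - m) / 3 * z ^+ 3 - 26 / 15 * z ^+ 5))).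
  exact: r_cont.
exact: c.
Qed.

Let is_derive_Psi y : m < y -> is_derive y 1 Psi (h y).
Proof.
move=> my; have ry : 0 < r y by rewrite sqrtr_gt0 mulr_gt0// subr_gt0.
have dr : is_derive y 1 r (3 / 52 * (r y)^-1).
  have H : is_derive y 1 (fun y : R => 3 / 26 * (y - m)) (3 / 26).
    by apply: is_derive_eq; rewrite /GRing.scale/= !(addr0, subr0, mulr0, mulr1, add0r).
  have H2 : is_derive (3 / 26 * (y - m)) 1 Num.sqrt (2 * Num.sqrt (3 / 26 * (y - m)))^-1.
    by apply: is_derive1_sqrt; rewrite mulr_gt0// subr_gt0.
  rewrite (_ : 3 / 52 * (r y)^-1 = (2 * Num.sqrt (3 / 26 * (y - m)))^-1 * (3 / 26)).
    exact: (@is_derive1_comp _ Num.sqrt (fun y : R => 3 / 26 * (y - m))).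
  by rewrite -/(r y); field; exact: lt0r_neq0.
have dP : is_derive (r y) 1
    (fun z : R => 208 / 3 * ((M - m) / 3 * z ^+ 3 - 26 / 15 * z ^+ 5))
    (208 / 3 * ((M - m) * r y ^+ 2 - 26 / 3 * r y ^+ 4)).
  by apply: is_derive_eq; rewrite /GRing.scale/=; field.
have -> : h y = 208 / 3 * ((M - m) * r y ^+ 2 - 26 / 3 * r y ^+ 4) * (3 / 52 * (r y)^-1).
  rewrite /h.
  have -> : M - y = (M - m) - 26 / 3 * r y ^+ 2 by rewrite r_sqr ?ltW//; field.
  by field; exact: lt0r_neq0.
exact: (is_derive1_comp dP dr).
Qed.

(* [(M - v) (g^2 + 24/13 (v - m)) >= 2 |h(v) g|] pointwise, with equality for
   the peakon, and [h(v) g] is the derivative of [Psi(v)]. *)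
Lemma peak_inequality v g xi eta w : periodic v 1 -> continuous v ->
  measurable_fun [set: R] g -> itv_integrable 0 1 (fun x => g x ^+ 2) ->
  primitive v g -> is_max_point v xi -> is_min_point v eta ->
  v xi = M -> v eta = m -> 0 <= w -> M - m = 3 / 26 * w ^+ 2 ->
  64 / 15 * (3 / 26) ^+ 3 * w ^+ 5 <=
  itv_int 0 1 (fun x => (M - v x) * (g x ^+ 2 + 24 / 13 * (v x - m))).
Proof.
move=> vp vc mg g2 vg vM vm vxi veta w0 Mm.
have vmM x : m <= v x <= M by rewrite -vxi -veta vM vm.
have mM : m <= M by have /andP[h1 h2] := vmM 0; exact: le_trans h2.
have PG : primitive (fun x => Psi (v x)) (fun x => h (v x) * g x).
  apply: (primitive_comp (m := m) (M := M)) => //.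
  move=> y z my yz zM.
  have dPsi x : x \in `]y, z[ -> is_derive x 1 Psi (h x).
    rewrite in_itv/= => /andP[yx _].
    by apply: is_derive_Psi; exact: le_lt_trans yx.
  have [c cyz Ec] := MVT_segment yz dPsi (continuous_subspaceT Psi_cont).
  by exists c => //; rewrite in_itv/= in cyz.
have v1 : v 1 = v 0 by rewrite -[in LHS](add0r 1) vp.
have [a a01 va] := periodic_itv eta vp.
have [b b01 vb] := periodic_itv xi vp.
(* The closed path Psi(v) passes through Psi m at the minimum of v and through Psi M at its
   maximum. *)
have := closed_variation_ge _ PG a01 b01; rewrite v1 va vb vxi veta => /(_ erefl) TV.
have rm : r m = 0 by rewrite /r subrr mulr0 sqrtr0.
have rM : r M = 3 / 26 * w.
  rewrite /r Mm.
  have -> : 3 / 26 * (3 / 26 * w ^+ 2) = (3 / 26 * w) ^+ 2 by ring.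
  by rewrite sqrtr_sqr ger0_norm// mulr_ge0.
have PMm : Psi M - Psi m = 16 / 15 * (3 / 26) ^+ 3 * w ^+ 5.
  by rewrite /Psi rm rM Mm; field.
have PMm0 : Psi M - Psi m <= `|Psi M - Psi m| := ler_norm _.
have hgi : itv_integrable 0 1 (fun x => `|h (v x) * g x|).
  exact: itv_integrable_norm PG.1.
(* 64/15 is 4 times the 16/15 of [PMm]: one factor 2 comes from the round trip, the other from the
   pointwise inequality. *)
apply: (@le_trans _ _ (itv_int 0 1 (fun x => 2 * `|h (v x) * g x|))).
  by rewrite itv_intZ//; lra.
apply: le_itv_int; first exact: itv_integrableZ.
  apply: itv_integrableM.
    by move=> x; apply: cvgB; [exact: cvg_cst|exact: vc].
  apply: itv_integrableD => //; apply: itv_integrable_cont => x.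
  by apply: (@continuous_comp _ _ _ v (fun y => 24 / 13 * (y - m)));
    [exact: vc|exact: affine_cont].
move=> x _; have /andP[mv vMx] := vmM x.
have hv0 : 0 <= M - v x by rewrite subr_ge0.
rewrite /h !normrM (ger0_norm hv0) (ger0_norm (r_ge0 _)) ger0_norm//.
have := r_sqr mv; rewrite -(real_normK (num_real (g x))).
move: `|g x| (r (v x)) => G s s2.
have -> : 24 / 13 * (v x - m) = 16 * s ^+ 2 by rewrite s2; field.
have : 0 <= (M - v x) * (G - 4 * s) ^+ 2 by rewrite mulr_ge0 ?sqr_ge0.
lra.
Qed.

End peak_inequality.

(** * H^1 functions paired with a derivative, and Poincare-type bounds *)

Section H1_pair.
Context {R : realType}.
Implicit Types (a b x y xi : R) (f g h k v w : R -> R).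

(** Carrying the derivative along makes pairs stable under linear combinations, whereas the
    representatives chosen by [wderiv] need not be additive pointwise. *)
Definition H1_pair f g : Prop :=
  [/\ periodic f 1, continuous f, L2 g & primitive f g].

Lemma H1_pair_wderiv f : sobolev1 f -> H1_pair f (wderiv f).
Proof.
move=> [fp fc [g gL fg]].
have [wL fw] : [set g : R -> R | L2 g /\ weak_deriv f g] (wderiv f).
  by apply: xgetPex; exists g.
by split => //; exact: primitive_weak_deriv.
Qed.

Lemma L2_lin a b g h : L2 g -> L2 h -> L2 (fun x => a * g x + b * h x).
Proof.
move=> [gp mg g2] [hp mh h2].
have ml : measurable_fun [set: R] (fun x => a * g x + b * h x).
  by apply: measurable_funD; apply: measurable_funM => //; exact: measurable_cst.
split => //; first by move=> x; rewrite gp hp.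
apply: (itv_integrable_le (measurable_funX 2 ml)
  (itv_integrableD (itv_integrableZ (2 * a ^+ 2) g2) (itv_integrableZ (2 * b ^+ 2) h2))).
move=> x _; rewrite ger0_norm ?sqr_ge0//.
have := sqr_ge0 (a * g x - b * h x); lra.
Qed.

Lemma H1_pair_lin a b f g h k : H1_pair f g -> H1_pair h k ->
  H1_pair (fun x => a * f x + b * h x) (fun x => a * g x + b * k x).
Proof.
move=> [fp fc gL [gi fg]] [hp hc kL [ki hk]].
have li := itv_integrableD (itv_integrableZ a gi) (itv_integrableZ b ki).
split.
- by move=> x; rewrite fp hp.
- by move=> x; apply: cvgD; apply: cvgM; (exact: cvg_cst || exact: fc || exact: hc).
- exact: L2_lin.
- split => // s t s0 st t1.
  have S l : itv_integrable 0 1 l -> itv_integrable s t l.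
    exact: itv_integrableS.
  rewrite itv_intD ?itv_intZ -?fg -?hk//; try (by exact: S); first ring.
  - exact/itv_integrableZ/S.
  - exact/itv_integrableZ/S.
Qed.

Lemma H1norm_pair f g : H1_pair f g ->
  H1norm f = Num.sqrt (itv_int 0 1 (fun x => f x ^+ 2) + itv_int 0 1 (fun x => g x ^+ 2)).
Proof.
move=> [fp fc gL fg].
have [|_ _ [_ mw w2] fw] := @H1_pair_wderiv f.
  by split => //; exists g => //; exact: weak_deriv_primitive.
by rewrite /H1norm (@primitive_unique _ f g (wderiv f))//; case: gL.
Qed.

Lemma phi_periodic : periodic (@phi R) 1.
Proof.
move=> x.
have E y : phi y = phi (y - 2^-1 + 2^-1) by rewrite subrK.
by rewrite (E (x + 1)) (E x) !phi_saw saw_periodic.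
Qed.

(** phi is a polynomial in the distance |y| from x to the nearest integer, and this distance is
    1-Lipschitz. *)
Lemma phi_continuous : continuous (@phi R).
Proof.
pose y (x : R) : R := saw 2^-1 x.
have yint (x : R) (n : int) : `|y x| <= `|x - n%:~R|.
  have yh : `|y x| <= 2^-1 by rewrite ler_norml saw_bound.
  pose j := (Num.floor (x - 2^-1) + 1 - n)%R.
  have xn : x - n%:~R = y x + j%:~R.
    by rewrite /y /saw /j rmorphB rmorphD /=; lra.
  have [j0|jn0] := eqVneq j 0; first by rewrite xn j0 addr0.
  have j1 : 1 <= `|j%:~R : R| by rewrite -intr_norm ler1z -gtz0_ge1 normr_gt0.
  rewrite xn; have := lerB_normD (j%:~R : R) (y x); rewrite [j%:~R + _]addrC; lra.
have ylip (s t : R) : `|y s| <= `|s - t| + `|y t|.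
  pose n := (Num.floor (t - 2^-1) + 1)%R.
  apply: (le_trans (yint s n)).
  have -> : s - n%:~R = (s - t) + y t by rewrite /y /saw /n rmorphD /=; lra.
  exact: ler_normD.
have yc : continuous (fun x => `|y x|).
  move=> x; apply/cvgrPdist_lt => e e0; near=> z.
  have xz : `|x - z| < e by near: z; exact: (cvgrPdist_lt _ _).1 cvg_id _ e0.
  apply: le_lt_trans xz; rewrite ler_norml.
  have h1 := ylip x z; have := ylip z x; rewrite (distrC z x) => h2.
  by apply/andP; split; lra.
have -> : @phi R = (fun z => 26^-1 * (12 * z ^+ 2 + 23)) \o (fun x => `|y x|).
  apply/funext => x /=.
  by rewrite real_normK ?num_real// -phi_saw subrK.
move=> x; apply: continuous_comp; first exact: yc.
by apply: derivable_continuous => ?; exact: ex_derive.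
Unshelve. all: by end_near. Qed.

Lemma H1_pair_phi xi : H1_pair (fun x => phi (x - xi + 2^-1))
  (fun x => 12 / 13 * saw xi x).
Proof.
split; last exact: primitive_phi.
- by move=> x; rewrite -[RHS]phi_periodic; congr phi; ring.
- move=> x; apply: (@continuous_comp _ _ _ (fun x => x - xi + 2^-1) phi).
    by apply: derivable_continuous => ?; exact: ex_derive.
  exact: phi_continuous.
- have := L2_lin (12 / 13) 0 (saw_L2 xi) (saw_L2 xi).
  by under eq_fun do rewrite mul0r addr0.
Qed.

(** Cauchy-Schwarz linearized by 2 d |g| <= g^2 + d^2, with the parameter d left to be chosen. *)
Lemma itv_int_norm_le g d : 0 < d -> L2 g ->
  itv_int 0 1 (fun x => `|g x|) <= (itv_int 0 1 (fun x => g x ^+ 2) / d + d) / 2.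
Proof.
move=> d0 gL; have [_ _ g2] := gL; have gi := L2_integrable gL.
have -> : (itv_int 0 1 (fun x => g x ^+ 2) / d + d) / 2 =
    itv_int 0 1 (fun x => (2 * d)^-1 * g x ^+ 2 + d / 2).
  rewrite itv_intD; [|exact: itv_integrableZ|exact: itv_integrable_cst].
  by rewrite itv_intZ// itv_int_cst ?ler01//; field; exact: lt0r_neq0.
apply: le_itv_int.
- exact: itv_integrable_norm.
- by apply: itv_integrableD; [exact: itv_integrableZ|exact: itv_integrable_cst].
- move=> x _; rewrite -(real_normK (num_real (g x))); move: `|g x| => G.
  rewrite -subr_ge0 (_ : _ - _ = (2 * d)^-1 * (G - d) ^+ 2).
    by rewrite mulr_ge0 ?sqr_ge0// invr_ge0 mulr_ge0// ltW.
  by field; exact: lt0r_neq0.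
Qed.

Lemma mean_sqr_le f : continuous f ->
  itv_int 0 1 f ^+ 2 <= itv_int 0 1 (fun x => f x ^+ 2).
Proof.
move=> fc; set J := itv_int 0 1 f.
have fi : itv_integrable 0 1 f by exact: itv_integrable_cont.
have f2i : itv_integrable 0 1 (fun x => f x ^+ 2) by exact: itv_integrableM.
have : 0 <= itv_int 0 1 (fun x => (f x - J) ^+ 2).
  by apply: itv_int_ge0 => x _; exact: sqr_ge0.
have -> : itv_int 0 1 (fun x => (f x - J) ^+ 2) =
    itv_int 0 1 (fun x => f x ^+ 2 + (- 2 * J * f x + J ^+ 2)).
  by apply: eq_itv_int => x _; ring.
have ci := @itv_integrable_cst R 0 1.
have i1 := itv_integrableZ (- 2 * J) fi.
rewrite itv_intD//; last exact: itv_integrableD.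
by rewrite itv_intD// itv_intZ// itv_int_cst ?ler01// -/J; lra.
Qed.

(** [closed_variation_ge], averaged over one of its two points. *)
Lemma H1_pair_osc f g x : H1_pair f g ->
  2 * `|f x - itv_int 0 1 f| <= itv_int 0 1 (fun x => `|g x|).
Proof.
move=> [fp fc gL fg]; set V := itv_int 0 1 (fun x => `|g x|).
have f1 : f 1 = f 0 by rewrite -[in LHS](add0r 1) fp.
have [x' x'01 <-] := periodic_itv x fp.
have fi : itv_integrable 0 1 f by exact: itv_integrable_cont.
have osc y : 0 <= y <= 1 -> 2 * `|f x' - f y| <= V.
  by move=> y01; exact: closed_variation_ge f1 fg y01 x'01.
have ci := @itv_integrable_cst R 0 1.
have E : f x' - itv_int 0 1 f = itv_int 0 1 (fun y => f x' - f y).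
  by rewrite itv_intB// itv_int_cst ?ler01// subr0 mulr1.
rewrite E mulrC -ler_pdivlMr//.
apply: (le_trans (ler_norm_itv_int (itv_integrableB (ci (f x')) fi))).
have -> : V / 2 = itv_int 0 1 (fun=> V / 2) by rewrite itv_int_cst ?ler01// subr0 mulr1.
apply: le_itv_int => //.
  exact/itv_integrable_norm/itv_integrableB.
by move=> y /osc; lra.
Qed.

(** With m the mean and V the variation, |f - m| <= V gives f^2 <= 2 m f + V^2 - m^2 pointwise. The
    bound of V^2 by the integral of g^2 is [itv_int_norm_le] at d = V. *)
Lemma poincare f g : H1_pair f g ->
  itv_int 0 1 (fun x => f x ^+ 2) <=
  itv_int 0 1 f ^+ 2 + itv_int 0 1 (fun x => g x ^+ 2).
Proof.
move=> fg; have [fp fc gL _] := fg; have [_ _ g2] := gL.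
have gi := L2_integrable gL.
pose V := itv_int 0 1 (fun x => `|g x|).
have V0 : 0 <= V by exact: itv_int_ge0.
have VE : V ^+ 2 <= itv_int 0 1 (fun x => g x ^+ 2).
  have [V00|Vn0] := eqVneq V 0.
    by rewrite V00 expr0n; apply: itv_int_ge0 => x _; exact: sqr_ge0.
  have Vp : 0 < V by rewrite lt_neqAle eq_sym Vn0.
  have := itv_int_norm_le Vp gL; rewrite -/V.
  rewrite ler_pdivlMr// -lerBlDr ler_pdivlMr//; lra.
have fi : itv_integrable 0 1 f by exact: itv_integrable_cont.
have f2 : itv_integrable 0 1 (fun x => f x ^+ 2) by exact: itv_integrableM.
have ci := @itv_integrable_cst R 0 1.
pose m := itv_int 0 1 f.
have : itv_int 0 1 (fun x => f x ^+ 2) <=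
    itv_int 0 1 (fun x => 2 * m * f x + (V ^+ 2 - m ^+ 2)).
  apply: le_itv_int => //; first by apply: itv_integrableD => //; exact: itv_integrableZ.
  move=> x _; have := H1_pair_osc x fg; rewrite -/V -/m => h.
  have : `|f x - m| ^+ 2 <= V ^+ 2.
    by rewrite lerXn2r ?nnegrE//; have := normr_ge0 (f x - m); lra.
  rewrite real_normK ?num_real//; lra.
rewrite itv_intD//; last exact: itv_integrableZ.
by rewrite itv_intZ// -/m itv_int_cst ?ler01// subr0 mulr1; lra.
Qed.

End H1_pair.

(** * Quantitative stability of the peakon of unit speed *)

Section stability.
Context {R : realType}.
Implicit Types (a b x y xi d : R) (f g h k v w : R -> R).

Definition energy g : R := itv_int 0 1 (fun x => g x ^+ 2).
(** Twice H_2, for any given representative g of the derivative. *)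
Definition moment f g : R :=
  itv_int 0 1 (fun x => 2 * itv_int 0 1 f * f x ^+ 2 + f x * g x ^+ 2).

Lemma energy_saw xi : energy (fun x => 12 / 13 * saw xi x) = 12 / 169.
Proof.
rewrite /energy; under eq_fun do rewrite exprMn.
have [_ _ s2] := saw_L2 xi.
by rewrite itv_intZ// itv_int_saw_sqr; field.
Qed.

(* For the peakon values of [mu], [E], [H], and with [M = m + D w^2], [D = 3/26],
   [p = (M + m - 49/26) / (2 D)], the left-hand side of the main inequality
   exceeds the right-hand side by
   [D^3 (16 p^2 + (w - 1)^2 (64/15 w^3 + 68/15 w^2 + 24/5 w + 12/5))],
   which controls the distance from [(M, m)] to the peakon values globally. *)
Lemma crest_height_defect (mu E H V M m w d : R) : 0 <= d ->
  `|mu - 12 / 13| <= d -> `|E - 12 / 169| <= 2 * d ->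
  `|H - peakon_ham2| <= 42 * d -> 0 <= V <= 9 -> - 3 <= m -> m <= M -> M <= 3 ->
  0 <= w -> M - m = 3 / 26 * w ^+ 2 ->
  64 / 15 * (3 / 26) ^+ 3 * w ^+ 5 <=
    M * E - H + 2 * (mu - 12 / 13) * V + 24 / 13 * (M * mu + m * mu - M * m) ->
  M <= 1 -> (1 - M) ^+ 2 <= 800 * d.
Proof.
move=> d0 hmu hE hH /andP[V0 V9] m3 mM M3 w0 Mm F M1.
(* The errors from replacing E, H, the factor of V, and mu by peakon values are 6, 42, 18 and 12
   times d, hence the 78 below. *)
have b1 : M * (E - 12 / 169) <= 6 * d.
  apply: (le_trans (ler_norm _)); rewrite normrM.
  have : `|M| <= 3 by rewrite ler_norml; apply/andP; split; lra.
  have := normr_ge0 M; have := normr_ge0 (E - 12 / 169); nra.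
have b2 : - (H - peakon_ham2) <= 42 * d.
  by apply: le_trans hH; rewrite -normrN ler_norm.
have b3 : 2 * (mu - 12 / 13) * V <= 18 * d.
  apply: (@le_trans _ _ (2 * d * 9)); last by lra.
  have : mu - 12 / 13 <= d by exact: le_trans (ler_norm _) hmu.
  nra.
have b4 : 24 / 13 * ((mu - 12 / 13) * (M + m)) <= 12 * d.
  suff : (mu - 12 / 13) * (M + m) <= 6 * d by lra.
  apply: (le_trans (ler_norm _)); rewrite normrM.
  have : `|M + m| <= 6 by rewrite ler_norml; apply/andP; split; lra.
  have := normr_ge0 (M + m); have := normr_ge0 (mu - 12 / 13); nra.
pose p := (M + m - 49 / 26) * (13 / 3).
have K : (3 / 26) ^+ 3 * (16 * p ^+ 2 + (w - 1) ^+ 2 *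
    (64 / 15 * w ^+ 3 + 68 / 15 * w ^+ 2 + 24 / 5 * w + 12 / 5)) <= 78 * d.
  have -> : (3 / 26) ^+ 3 * (16 * p ^+ 2 + (w - 1) ^+ 2 *
    (64 / 15 * w ^+ 3 + 68 / 15 * w ^+ 2 + 24 / 5 * w + 12 / 5)) =
    64 / 15 * (3 / 26) ^+ 3 * w ^+ 5 - (M * (12 / 169) - peakon_ham2 +
      24 / 13 * (12 / 13 * (M + m) - M * m)).
    have -> : M = m + 3 / 26 * w ^+ 2 by lra.
    rewrite /p /peakon_ham2 (_ : M = m + 3 / 26 * w ^+ 2); last by lra.
    by field.
  lra.
have w2 : 0 <= w ^+ 2 by exact: sqr_ge0.
have w3 : 0 <= w ^+ 3 by exact: exprn_ge0.
have K2 : (3 / 26) ^+ 3 * (12 / 5 * (p ^+ 2 + (w - 1) ^+ 2)) <= 78 * d.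
  apply: le_trans K; apply: ler_wpM2l; first by apply: exprn_ge0; lra.
  have p2 : 0 <= p ^+ 2 by exact: sqr_ge0.
  have s2 : 0 <= (w - 1) ^+ 2 by exact: sqr_ge0.
  have : 0 <= (w - 1) ^+ 2 * (64 / 15 * w ^+ 3 + 68 / 15 * w ^+ 2 + 24 / 5 * w).
    by rewrite mulr_ge0//; lra.
  lra.
have ME : 1 - M = 3 / 26 * (- p + (1 - w) * (1 + w) / 2).
  by rewrite /p; have : w ^+ 2 = 26 / 3 * (M - m) by [lra]; lra.
pose q := `|p| + `|w - 1|.
have q0 : 0 <= q by rewrite addr_ge0.
have Mq : 1 - M <= 3 / 26 * q.
  rewrite ME; apply: ler_wpM2l; first lra.
  have p1 : - p <= `|p| by rewrite -normrN ler_norm.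
  have w1 : 1 - w <= `|w - 1| by rewrite distrC ler_norm.
  have w10 := normr_ge0 (w - 1).
  rewrite /q; apply: lerD => //.
  (* For w <= 1 the factor (1 + w) / 2 is at most 1; for w > 1 the product with 1 - w is
     negative. *)
  have [w1'|w1'] := leP w 1; nra.
apply: (@le_trans _ _ ((3 / 26 * q) ^+ 2)).
  by rewrite lerXn2r ?nnegrE//; lra.
have q2 : q ^+ 2 <= 2 * (p ^+ 2 + (w - 1) ^+ 2).
  rewrite /q -[in leRHS](real_normK (num_real p)) -[in leRHS](real_normK (num_real (w - 1))).
  have := sqr_ge0 (`|p| - `|w - 1|); lra.
(* The constant obtained is 2 * 78 * 5/12 * 26/3 = 1690/3, below 800. *)
lra.
Qed.

(** The integral in [peak_inequality] expands into M, m and the conserved quantities, except for the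
    term 2 (mu - 12/13) V, V being the integral of v^2: the inequality carries twice the peakon's
    mean, 24/13, but [moment] carries twice the mean of v. *)
Lemma crest_height v g xi d : H1_pair v g -> 0 <= d <= 1 ->
  `|itv_int 0 1 v - 12 / 13| <= d -> `|energy g - 12 / 169| <= 2 * d ->
  `|moment v g - peakon_ham2| <= 42 * d ->
  is_max_point v xi -> v xi <= 1 -> (1 - v xi) ^+ 2 <= 800 * d.
Proof.
move=> vg /andP[d0 d1] hmu hE hH vM M1.
have [vp vc gL gv] := vg; have [_ mg g2] := gL.
have [eta vm] : exists eta, is_min_point v eta.
  have [eta _ vm] := EVT_min ler01 (continuous_subspaceT vc).
  exists eta => x; have [y y01 <-] := periodic_itv x vp.
  by apply: vm; rewrite in_itv.
set mu := itv_int 0 1 v in hmu; set M := v xi in M1 *; pose m := v eta.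
(* Since d <= 1, crude bounds hold: energy at most 3, then |v - mu| <= 1, |mu| <= 2 and |v| <= 3, as
   [crest_height_defect] requires. *)
have E2 : energy g <= 3 by have := le_trans (ler_norm _) hE; lra.
have V2 := itv_int_norm_le ltr01 gL.
have osc x : `|v x - mu| <= 1.
  have := H1_pair_osc x vg; rewrite -/mu => h.
  have : itv_int 0 1 (fun x => `|g x|) <= 2.
    by apply: (le_trans V2); rewrite divr1 -/(energy g); lra.
  lra.
have mu2 : `|mu| <= 2.
  rewrite (_ : mu = (mu - 12 / 13) + 12 / 13); last by ring.
  by rewrite (le_trans (ler_normD _ _))// [X in _ + X]ger0_norm; lra.
have v3 x : `|v x| <= 3.
  rewrite (_ : v x = (v x - mu) + mu); last by ring.
  by rewrite (le_trans (ler_normD _ _))//; have := osc x; lra.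
have mM : m <= M by exact: vM.
pose w := Num.sqrt (26 / 3 * (M - m)).
have w0 : 0 <= w by exact: sqrtr_ge0.
have Mm : M - m = 3 / 26 * w ^+ 2.
  by rewrite sqr_sqrtr ?mulr_ge0 ?subr_ge0//; field.
have vi : itv_integrable 0 1 v by exact: itv_integrable_cont.
have v2i : itv_integrable 0 1 (fun x => v x ^+ 2) by exact: itv_integrableM.
have vg2i : itv_integrable 0 1 (fun x => v x * g x ^+ 2) by exact: itv_integrableM.
pose V := itv_int 0 1 (fun x => v x ^+ 2).
have V09 : 0 <= V <= 9.
  apply/andP; split; first by apply: itv_int_ge0 => x _; exact: sqr_ge0.
  have -> : 9 = itv_int 0 1 (fun=> 9) :> R by rewrite itv_int_cst ?ler01// subr0 mulr1.
  apply: le_itv_int => //; first exact: itv_integrable_cst.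
  move=> x _; rewrite -(real_normK (num_real (v x))).
  by have := v3 x; have := normr_ge0 (v x); nra.
apply: (@crest_height_defect mu (energy g) (moment v g) V M m w) => //.
- by have := v3 eta; rewrite ler_norml => /andP[].
- by have := v3 xi; rewrite ler_norml => /andP[].
have := peak_inequality vp vc mg g2 gv vM vm (erefl M) (erefl m) w0 Mm.
move=> /le_trans; apply.
have -> : moment v g = 2 * mu * V + itv_int 0 1 (fun x => v x * g x ^+ 2).
  by rewrite /moment itv_intD ?itv_intZ//; exact: itv_integrableZ.
rewrite le_eqVlt; apply/orP; left; apply/eqP.
transitivity (itv_int 0 1 (fun x => (M * g x ^+ 2 - v x * g x ^+ 2) +
   24 / 13 * ((M + m) * v x + (- v x ^+ 2 + - (M * m))))).
  by apply: eq_itv_int => x _; ring.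
have ci := @itv_integrable_cst R 0 1.
have i1 : itv_integrable 0 1 (fun x => - v x ^+ 2).
  by under eq_fun do rewrite -mulN1r; exact: itv_integrableZ.
have i2 := itv_integrableD i1 (ci (- (M * m))).
have i3 := itv_integrableD (itv_integrableZ (M + m) vi) i2.
rewrite itv_intD; last 2 first.
- by apply: itv_integrableB => //; exact: itv_integrableZ.
- exact: itv_integrableZ.
rewrite itv_intB//; last exact: itv_integrableZ.
rewrite !itv_intZ// itv_intD//; last exact: itv_integrableZ.
rewrite itv_intD// itv_intZ// itv_int_cst ?ler01//.
have -> : itv_int 0 1 (fun x => - v x ^+ 2) = - V.
  by under eq_fun do rewrite -mulN1r; rewrite itv_intZ// mulN1r.
rewrite -/mu -/(energy g); ring.
Qed.

Lemma phi_itv x : 0 <= phi x <= 1.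
Proof.
rewrite -(subrK 2^-1 x) phi_saw; have := saw_bound 2^-1 x.
by move=> /andP[h1 h2]; apply/andP; split; nra.
Qed.

(** With w and k the differences from the peakon and its derivative p, |w| <= 2 d everywhere by the
    oscillation bound. From g^2 - p^2 = k^2 + 2 k p and |p| <= 1/2, the energies differ by at most
    d^2 + d. *)
Lemma functionals_near_peakon v g xi d : H1_pair v g -> 0 < d -> d <= 1 ->
  itv_int 0 1 (fun x => (v x - phi (x - xi + 2^-1)) ^+ 2) +
  itv_int 0 1 (fun x => (g x - 12 / 13 * saw xi x) ^+ 2) <= d ^+ 2 ->
  [/\ `|itv_int 0 1 v - 12 / 13| <= d, `|energy g - 12 / 169| <= 2 * d &
      `|moment v g - peakon_ham2| <= 42 * d].
Proof.
move=> vg d0 d1 dist.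
have [vp vc gL gv] := vg; have [_ mg g2] := gL.
pose F x := phi (x - xi + 2^-1); pose p x := 12 / 13 * saw xi x.
have Fp : H1_pair F p by exact: H1_pair_phi.
have [_ Fc pL _] := Fp; have [_ mp p2] := pL.
pose w x := 1 * v x + (-1) * F x; pose k x := 1 * g x + (-1) * p x.
have wE x : w x = v x - F x by rewrite /w; ring.
have kE x : k x = g x - p x by rewrite /k; ring.
have wk : H1_pair w k by exact: H1_pair_lin.
have [_ wc kL _] := wk; have [_ mk k2] := kL.
have nn f : 0 <= itv_int 0 1 (fun x => f x ^+ 2).
  by apply: itv_int_ge0 => x _; exact: sqr_ge0.
have {}dist : itv_int 0 1 (fun x => w x ^+ 2) + itv_int 0 1 (fun x => k x ^+ 2) <= d ^+ 2.
  by under eq_fun do rewrite wE; under [X in _ + itv_int _ _ X]eq_fun do rewrite kE.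
have w2d : itv_int 0 1 (fun x => w x ^+ 2) <= d ^+ 2 by have := nn k; lra.
have k2d : itv_int 0 1 (fun x => k x ^+ 2) <= d ^+ 2 by have := nn w; lra.
have half (X : R) : X <= d ^+ 2 -> (X / d + d) / 2 <= d.
  by move=> Xd; have : X / d <= d by [rewrite ler_pdivrMr]; lra.
have k1d : itv_int 0 1 (fun x => `|k x|) <= d.
  by apply: (le_trans (itv_int_norm_le d0 kL)); exact: half.
have vi : itv_integrable 0 1 v by exact: itv_integrable_cont.
have Fi : itv_integrable 0 1 F by exact: itv_integrable_cont.
have wi : itv_integrable 0 1 w by exact: itv_integrable_cont.
have w2i : itv_integrable 0 1 (fun x => w x ^+ 2) by exact: itv_integrableM.
have muE : itv_int 0 1 w = itv_int 0 1 v - 12 / 13.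
  rewrite -(itv_int_phi xi) -/F -itv_intB//.
  by apply: eq_itv_int => x _; rewrite wE.
have w1d : `|itv_int 0 1 w| <= d.
  rewrite -(ler_pXn2r (n := 2)) ?nnegrE ?(ltW d0)// real_normK ?num_real//.
  exact: le_trans (mean_sqr_le wc) w2d.
have wsup x : `|w x| <= 2 * d.
  have := H1_pair_osc x wk => h.
  have : `|w x| <= `|w x - itv_int 0 1 w| + `|itv_int 0 1 w|.
    by have := ler_normD (w x - itv_int 0 1 w) (itv_int 0 1 w); rewrite subrK.
  lra.
have pb x : `|p x| <= 2^-1.
  by have := saw_bound xi x; rewrite ler_norml /p => /andP[h1 h2]; apply/andP; split; lra.
have Fb x : 0 <= F x <= 1 by exact: phi_itv.
have dgp x : `|g x ^+ 2 - p x ^+ 2| <= k x ^+ 2 + `|k x|.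
  have -> : g x ^+ 2 - p x ^+ 2 = k x ^+ 2 + 2 * (k x * p x).
    by rewrite kE; ring.
  rewrite (le_trans (ler_normD _ _))// ger0_norm ?sqr_ge0// lerD//.
  rewrite normrM (ger0_norm (ler0n _ 2)) (normrM (k x)).
  have : `|k x| * `|p x| <= `|k x| * 2^-1 by rewrite ler_wpM2l.
  lra.
have nki : itv_integrable 0 1 (fun x => `|k x|).
  exact/itv_integrable_norm/L2_integrable.
have eE : `|energy g - 12 / 169| <= 2 * d.
  rewrite -(energy_saw xi) /energy -itv_intB//.
  apply: (le_trans (ler_norm_itv_int (itv_integrableB g2 p2))).
  apply: (@le_trans _ _ (itv_int 0 1 (fun x => k x ^+ 2 + `|k x|))).
    apply: le_itv_int => //; last exact: itv_integrableD.
    exact/itv_integrable_norm/itv_integrableB.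
  by rewrite itv_intD//; nra.
split => //; first by rewrite -muE.
have -> : peakon_ham2 = itv_int 0 1 (fun x => 24 / 13 * F x ^+ 2 + F x * p x ^+ 2).
  by rewrite itv_int_phi_ham2.
have v2i : itv_integrable 0 1 (fun x => v x ^+ 2) by exact: itv_integrableM.
have F2i : itv_integrable 0 1 (fun x => F x ^+ 2) by exact: itv_integrableM.
have vg2i : itv_integrable 0 1 (fun x => v x * g x ^+ 2) by exact: itv_integrableM.
have Fp2i : itv_integrable 0 1 (fun x => F x * p x ^+ 2) by exact: itv_integrableM.
have I1 := itv_integrableD (itv_integrableZ (2 * itv_int 0 1 v) v2i) vg2i.
have I2 := itv_integrableD (itv_integrableZ (24 / 13) F2i) Fp2i.
rewrite /moment -itv_intB//.
apply: (le_trans (ler_norm_itv_int (itv_integrableB I1 I2))).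
have ci := @itv_integrable_cst R 0 1.
(* 34 = 18 + 16 bounds the terms of the first summand of H_2, doubled; 2 d times the energy adds at
   most 6 d, and k^2 + |k| at most 2 d, hence 42 d. *)
have I3 := itv_integrableD (ci (34 * d)) (itv_integrableD
  (itv_integrableZ (2 * d) g2) (itv_integrableD k2 nki)).
apply: (le_trans (le_itv_int (itv_integrable_norm (itv_integrableB I1 I2)) I3 _)).
  move=> x _; set mv := itv_int 0 1 v in muE *.
  have -> : 2 * mv * v x ^+ 2 + v x * g x ^+ 2 -
      (24 / 13 * F x ^+ 2 + F x * p x ^+ 2) =
    (2 * (itv_int 0 1 w * v x ^+ 2) + 24 / 13 * (w x * (w x + 2 * F x))) +
    (w x * g x ^+ 2 + F x * (g x ^+ 2 - p x ^+ 2)).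
    by rewrite muE wE; ring.
  have vb : `|v x| <= 3.
    have -> : v x = w x + F x by rewrite wE; ring.
    rewrite (le_trans (ler_normD _ _))//; have /andP[f0 f1] := Fb x.
    by rewrite (ger0_norm f0); have := wsup x; lra.
  have := wsup x; have := normr_ge0 (w x); have /andP[f0 f1] := Fb x => w0 w1.
  apply: (le_trans (ler_normD _ _)); apply: lerD; last first.
    apply: (le_trans (ler_normD _ _)); apply: lerD.
      by rewrite normrM (ger0_norm (sqr_ge0 _)) ler_wpM2r ?sqr_ge0.
    by rewrite normrM (ger0_norm f0) (le_trans _ (dgp x))// ler_piMl.
  apply: (le_trans (ler_normD _ _)).
  have t1 : `|2 * (itv_int 0 1 w * v x ^+ 2)| <= 18 * d.
    rewrite normrM (ger0_norm (ler0n _ 2)) normrM (ger0_norm (sqr_ge0 (v x))).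
    have v9 : v x ^+ 2 <= 9.
      by rewrite -(real_normK (num_real (v x))); have := normr_ge0 (v x); nra.
    have := ler_pM (normr_ge0 _) (sqr_ge0 (v x)) w1d v9; lra.
  have t2 : `|24 / 13 * (w x * (w x + 2 * F x))| <= 16 * d.
    have c0 : 0 <= 24 / 13 :> R by lra.
    rewrite normrM (ger0_norm c0) (normrM (w x)).
    have w4 : `|w x + 2 * F x| <= 4.
      rewrite (le_trans (ler_normD _ _))// (ger0_norm (_ : 0 <= 2 * F x)); lra.
    have := ler_pM (normr_ge0 _) (normr_ge0 _) w1 w4; lra.
  lra.
have kn := itv_integrableD k2 nki.
have g2d := itv_integrableZ (2 * d) g2.
rewrite itv_intD//; last exact: itv_integrableD.
rewrite itv_intD// itv_intD// (itv_intZ (2 * d) g2) itv_int_cst ?ler01//.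
have e3 : energy g <= 3 by have := le_trans (ler_norm _) eE; lra.
have : d * energy g <= d * 3 by rewrite ler_wpM2l// ltW.
have : d ^+ 2 <= d by rewrite expr2 ler_piMl// ltW.
rewrite -/(energy g) subr0; lra.
Qed.

(** [itv_int_saw_deriv] evaluates the cross term, so the derivative part of the distance equals (E -
    12/169) + 24/13 (mu - 12/13) + 24/13 (1 - v xi). The Poincare inequality bounds the other part
    by this one plus (mu - 12/13)^2. *)
Lemma orbit_distance v g xi d : H1_pair v g -> 0 <= d <= 1 ->
  `|itv_int 0 1 v - 12 / 13| <= d -> `|energy g - 12 / 169| <= 2 * d ->
  itv_int 0 1 (fun x => (v x - phi (x - xi + 2^-1)) ^+ 2) +
  itv_int 0 1 (fun x => (g x - 12 / 13 * saw xi x) ^+ 2) <=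
  10 * d + 4 * Num.max 0 (1 - v xi).
Proof.
move=> vg /andP[d0 d1] hmu hE.
have [vp vc gL gv] := vg; have [_ mg g2] := gL.
pose F x := phi (x - xi + 2^-1); pose p x := 12 / 13 * saw xi x.
have Fp : H1_pair F p by exact: H1_pair_phi.
have [_ Fc pL _] := Fp; have [_ mp p2] := pL.
pose w x := 1 * v x + (-1) * F x; pose k x := 1 * g x + (-1) * p x.
have wE x : w x = v x - F x by rewrite /w; ring.
have kE x : k x = g x - p x by rewrite /k; ring.
have wk : H1_pair w k by exact: H1_pair_lin.
have vi : itv_integrable 0 1 v by exact: itv_integrable_cont.
have Fi : itv_integrable 0 1 F by exact: itv_integrable_cont.
have muE : itv_int 0 1 w = itv_int 0 1 v - 12 / 13.
  rewrite -(itv_int_phi xi) -/F -itv_intB//.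
  by apply: eq_itv_int => x _; rewrite wE.
have pw := poincare wk.
under eq_fun do rewrite -wE.
under [X in _ + itv_int _ _ X]eq_fun do rewrite -kE.
have sgi : itv_integrable 0 1 (fun x => saw xi x * g x).
  apply: (itv_integrable_bdM (B := 2^-1) (measurable_saw xi)) => [x|].
    by rewrite ler_norml saw_bound.
  exact: L2_integrable.
have kint : itv_int 0 1 (fun x => k x ^+ 2) =
    energy g - 24 / 13 * (v xi - itv_int 0 1 v) + 12 / 169.
  rewrite -(itv_int_saw_deriv xi vp vc gv) -(energy_saw xi) /energy -itv_intZ//.
  rewrite -itv_intB//; last exact: itv_integrableZ.
  rewrite -itv_intD//; last by apply: itv_integrableB => //; exact: itv_integrableZ.
  by apply: eq_itv_int => x _; rewrite kE /p; field.
have M0 : 1 - v xi <= Num.max 0 (1 - v xi) by rewrite le_max lexx orbT.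
have M1 : 0 <= Num.max 0 (1 - v xi) by rewrite le_max lexx.
move: pw M0 M1; rewrite kint muE => pw.
have := hmu; have := hE; rewrite !ler_norml => /andP[e1 e2] /andP[m1 m2].
have : (itv_int 0 1 v - 12 / 13) ^+ 2 <= d by nra.
lra.
Qed.

(** * Reduction to unit speed, and the stability theorem *)

Lemma sqrtr_ltr_sqr (x e : R) : 0 < e -> x < e ^+ 2 -> Num.sqrt x < e.
Proof.
move=> e0 xe; rewrite -(ger0_norm (ltW e0)) -sqrtr_sqr ltr_sqrt//.
by rewrite exprn_gt0.
Qed.

Lemma ltr_sqr_sqrtr (x e : R) : 0 <= x -> Num.sqrt x < e -> x < e ^+ 2.
Proof.
by move=> x0 xe; rewrite -(sqr_sqrtr x0) ltrXn2r ?nnegrE ?sqrtr_ge0.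
Qed.

Lemma H1_pairZ a f g : H1_pair f g ->
  H1_pair (fun x => a * f x) (fun x => a * g x).
Proof.
move=> fg; have := H1_pair_lin a 0 fg fg.
by under eq_fun do rewrite mul0r addr0; under [X in H1_pair _ X]eq_fun do rewrite mul0r addr0.
Qed.

Lemma energyZ a g : L2 g -> energy (fun x => a * g x) = a ^+ 2 * energy g.
Proof.
by move=> [_ _ g2]; rewrite /energy -itv_intZ//; apply: eq_itv_int => x _; rewrite exprMn.
Qed.

Lemma momentZ a f g : H1_pair f g ->
  moment (fun x => a * f x) (fun x => a * g x) = a ^+ 3 * moment f g.
Proof.
move=> [_ fc [_ _ g2] _].
have fi : itv_integrable 0 1 f by exact: itv_integrable_cont.
have f2i : itv_integrable 0 1 (fun x => f x ^+ 2) by exact: itv_integrableM.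
have fg2i : itv_integrable 0 1 (fun x => f x * g x ^+ 2) by exact: itv_integrableM.
rewrite /moment (itv_intZ a fi) -(itv_intZ (a ^+ 3)); last first.
  by apply: itv_integrableD => //; exact: itv_integrableZ.
by apply: eq_itv_int => x _; ring.
Qed.

Lemma H1norm_sub_peakon f g xi c : c != 0 -> H1_pair f g ->
  H1norm (fun x => f x - c * phi (x - xi + 2^-1)) = `|c| * Num.sqrt
    (itv_int 0 1 (fun x => (c^-1 * f x - phi (x - xi + 2^-1)) ^+ 2) +
     itv_int 0 1 (fun x => (c^-1 * g x - 12 / 13 * saw xi x) ^+ 2)).
Proof.
move=> c0 fg; have FP := H1_pair_phi xi.
have := H1_pair_lin c^-1 (-1) fg FP.
set w := (fun x => _); set k := (fun x => _) => wk.
have [_ wc [_ _ k2] _] := wk.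
have -> : (fun x => f x - c * phi (x - xi + 2^-1)) = (fun x => c * w x).
  by apply/funext => x; rewrite /w; field.
rewrite (H1norm_pair (H1_pairZ c wk)).
have wE x : w x = c^-1 * f x - phi (x - xi + 2^-1) by rewrite /w; ring.
have kE x : k x = c^-1 * g x - 12 / 13 * saw xi x by rewrite /k; ring.
under [in RHS]eq_fun do rewrite -wE.
under [X in _ = _ * Num.sqrt (_ + itv_int _ _ X)]eq_fun do rewrite -kE.
have w2 : itv_integrable 0 1 (fun x => w x ^+ 2).
  by apply: itv_integrableM => //; exact: itv_integrable_cont.
rewrite -sqrtr_sqr -sqrtrM ?sqr_ge0// mulrDr -(itv_intZ (c ^+ 2) w2) -(itv_intZ (c ^+ 2) k2).
by congr (Num.sqrt (_ + _)); apply: eq_itv_int => x _; rewrite exprMn.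
Qed.

(** H_0 is the mean, and subtracting its square from 2 H_1 leaves the energy; the moment is 2
    H_2. *)
Lemma weak_solution_conserved (T : \bar R) (u : R -> R -> R) (t : R) :
  weak_solution T u -> 0 <= t -> (t%:E < T)%E ->
  [/\ H1_pair (u 0) (wderiv (u 0)), H1_pair (u t) (wderiv (u t)),
      itv_int 0 1 (u t) = itv_int 0 1 (u 0),
      energy (wderiv (u t)) = energy (wderiv (u 0)) &
      moment (u t) (wderiv (u t)) = moment (u 0) (wderiv (u 0))].
Proof.
move=> [T0 [us _] _ cons] t0 tT.
have P0 := H1_pair_wderiv (us 0 (lexx _) T0).
have Pt := H1_pair_wderiv (us t t0 tT).
have [h0 h1 h2] := cons t t0 tT.
have mE : itv_int 0 1 (u t) = itv_int 0 1 (u 0) := h0.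
split; [exact: P0|exact: Pt|exact: mE| |].
  have h2n : (2^-1 : R) != 0 by rewrite invr_neq0.
  have : itv_int 0 1 (u t) ^+ 2 + energy (wderiv (u t)) =
         itv_int 0 1 (u 0) ^+ 2 + energy (wderiv (u 0)) := mulfI h2n h1.
  rewrite mE; exact: addrI.
have M f g : H1_pair f g -> moment f g =
    2 * circle_int (fun x => mean f * f x ^+ 2 + 2^-1 * (f x * g x ^+ 2)).
  move=> [_ fc [_ _ g2] _].
  rewrite /circle_int -/(itv_int _ _ _) -itv_intZ.
    by apply: eq_itv_int => x _; rewrite /mean /circle_int -/(itv_int _ _ _); field.
  apply: itv_integrableD; apply: itv_integrableZ; last exact: itv_integrableM.
  by apply: itv_integrable_cont => x; apply: cvgM; exact: fc.
by rewrite (M _ _ Pt) (M _ _ P0); exact: (congr1 (fun z => 2 * z) h2).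
Qed.

(** Time enters only through conservation, so it is replaced by two functions sharing the three
    quantities: closeness of the first to phi fixes these values, and they force the second to be
    near a translate. *)
Lemma peakon_static_stability (e : R) : 0 < e -> exists2 d : R, 0 < d &
  forall v0 g0 v g, H1_pair v0 g0 -> H1_pair v g ->
    itv_int 0 1 v = itv_int 0 1 v0 -> energy g = energy g0 ->
    moment v g = moment v0 g0 ->
    itv_int 0 1 (fun x => (v0 x - phi (x - 2^-1 + 2^-1)) ^+ 2) +
    itv_int 0 1 (fun x => (g0 x - 12 / 13 * saw 2^-1 x) ^+ 2) < d ^+ 2 ->
  forall xi, is_max_point v xi ->
    itv_int 0 1 (fun x => (v x - phi (x - xi + 2^-1)) ^+ 2) +
    itv_int 0 1 (fun x => (g x - 12 / 13 * saw xi x) ^+ 2) < e ^+ 2.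
Proof.
(* With d <= e^2 / 40 and 1 - v xi <= tau, the bound of [orbit_distance] is at most e^2 / 2; the
   condition 800 d <= tau^2 secures 1 - v xi <= tau by [crest_height]. *)
move=> e0; pose tau := e ^+ 2 / 16.
have e2 : 0 < e ^+ 2 by exact: exprn_gt0.
have tau0 : 0 < tau by rewrite /tau; lra.
have tau2 : 0 < tau ^+ 2 by exact: exprn_gt0.
pose d := Num.min 1 (Num.min (e ^+ 2 / 40) (tau ^+ 2 / 800)).
have e40 : 0 < e ^+ 2 / 40 by lra.
have tau800 : 0 < tau ^+ 2 / 800 by lra.
have d0 : 0 < d by rewrite !lt_min ltr01 e40 tau800.
have d1 : d <= 1 by rewrite ge_min lexx.
have de : d <= e ^+ 2 / 40 by rewrite !ge_min lexx orbT.
have dtau : 800 * d <= tau ^+ 2.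
  have : d <= tau ^+ 2 / 800 by rewrite !ge_min lexx !orbT.
  lra.
have d01 : 0 <= d <= 1 by rewrite ltW.
have arith (z : R) : z <= tau -> 10 * d + 4 * z < e ^+ 2.
  by rewrite /tau; lra.
exists d => // v0 g0 v g P0 P mE eE hE dist xi vmax.
have [] := functionals_near_peakon P0 d0 d1 (ltW dist).
rewrite -mE -eE -hE => m0 n0 h0.
apply: (le_lt_trans (orbit_distance xi P d01 m0 n0)); apply: arith.
rewrite ge_max (ltW tau0)/=.
have [v1|/ltW v1] := leP (v xi) 1; last first.
  by rewrite (le_trans _ (ltW tau0))// subr_le0.
rewrite -(ler_pXn2r (n := 2)) ?nnegrE ?subr_ge0 ?(ltW tau0)//.
exact: le_trans (crest_height P d01 m0 n0 h0 vmax v1) dtau.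
Qed.

Lemma itv_int_contZ a f : continuous f ->
  itv_int 0 1 (fun x => a * f x) = a * itv_int 0 1 f.
Proof. by move=> fc; apply: itv_intZ; exact: itv_integrable_cont. Qed.

End stability.

Theorem theorem1p1 (R : realType) (c eps : R) (eps_gt0 : 0 < eps) :
  exists2 delta : R, 0 < delta &
    forall (T : \bar R) (u : R -> R -> R),
      weak_solution T u ->
      H1norm (fun x => u 0 x - c * phi x) < delta ->
      forall t : R, 0 <= t -> (t%:E < T)%E ->
      forall xi : R, is_peak_point c (u t) xi ->
        H1norm (fun x => u t x - c * phi (x - xi + 2^-1)) < eps.
Proof.
(* For c = 0 there is nothing to rescale and the wave is zero: by the Poincare inequality the
   conserved mean and energy control the H^1 norm directly. *)
have [->|c0] := eqVneq c 0.
  have arith (J A B E : R) : J ^+ 2 <= A -> B <= J ^+ 2 + E ->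
      A + E < (eps / 2) ^+ 2 -> B + E < eps ^+ 2.
    have ee : 0 < eps ^+ 2 by rewrite exprn_gt0.
    have J0 : 0 <= J ^+ 2 by exact: sqr_ge0.
    move=> h1 h2 h3; lra.
  exists (eps / 2); first by rewrite divr_gt0.
  move=> T u uT; under eq_fun do rewrite mul0r subr0.
  move=> dist t t0 tT xi _; under eq_fun do rewrite mul0r subr0.
  have [P0 Pt mE eE _] := weak_solution_conserved uT t0 tT.
  have [_ uc _ _] := P0.
  have h1 : itv_int 0 1 (u 0) ^+ 2 <= energy (u 0) := mean_sqr_le uc.
  have h2 : energy (u t) <= itv_int 0 1 (u t) ^+ 2 + energy (wderiv (u t)).
    exact: poincare Pt.
  rewrite (H1norm_pair Pt); rewrite (H1norm_pair P0) in dist.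
  have nn (f : R -> R) : 0 <= energy f by apply: itv_int_ge0 => x _; exact: sqr_ge0.
  have S0 : energy (u 0) + energy (wderiv (u 0)) < (eps / 2) ^+ 2.
    exact: ltr_sqr_sqrtr (addr_ge0 (nn (u 0)) (nn (wderiv (u 0)))) dist.
  rewrite mE in h2.
  have St : energy (u t) + energy (wderiv (u t)) < eps ^+ 2.
    by rewrite eE in h2 *; exact: arith h1 h2 S0.
  exact: sqrtr_ltr_sqr eps_gt0 St.
have ac : 0 < `|c| by rewrite normr_gt0.
have e0 : 0 < eps / `|c| by rewrite divr_gt0.
have [d d0 stab] := peakon_static_stability e0.
exists (`|c| * d); first exact: mulr_gt0.
move=> T u uT dist t t0 tT xi peak.
have [P0 Pt mE eE hE] := weak_solution_conserved uT t0 tT.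
have [_ u0c g0L _] := P0; have [_ utc gtL _] := Pt.
rewrite (H1norm_sub_peakon xi c0 Pt) -[ltRHS](divfK (lt0r_neq0 ac)).
rewrite [ltRHS]mulrC (ltr_pM2l ac).
apply: (sqrtr_ltr_sqr e0); apply: (stab _ _ _ _ (H1_pairZ c^-1 P0) (H1_pairZ c^-1 Pt)).
- by rewrite (itv_int_contZ _ utc) (itv_int_contZ _ u0c) mE.
- by rewrite (energyZ _ gtL) (energyZ _ g0L) eE.
- by rewrite (momentZ _ Pt) (momentZ _ P0) hE.
- have phiE : (fun x => u 0 x - c * phi x) = (fun x => u 0 x - c * phi (x - 2^-1 + 2^-1)).
    by apply/funext => x; rewrite subrK.
  rewrite phiE (H1norm_sub_peakon _ c0 P0) (ltr_pM2l ac) in dist.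
  apply: (ltr_sqr_sqrtr _ dist).
  by apply: addr_ge0; apply: itv_int_ge0 => x _; exact: sqr_ge0.
(* Division by a negative c reverses the order, so a minimum of u becomes a maximum of u / c. *)
- move=> x; move: peak; rewrite /is_peak_point; case: (leP 0 c) => [cp|cn] ux.
    have ci : 0 < c^-1 by rewrite invr_gt0 lt_neqAle eq_sym c0 cp.
    rewrite (ler_pM2l ci); exact: ux.
  have ci : c^-1 < 0 by rewrite invr_lt0.
  rewrite (ler_nM2l ci); exact: ux.
Qed.
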